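(* Let $b_{\rm shunt},I_{\rm shunt}\in\mathbb{R}^n$ and consider constant-impedance/constant-current loads $$Q_L^{\rm ZI}(E_L)=[E_L][b_{\rm shunt}]E_L+[E_L]I_{\rm shunt}.$$ Assume that (i) $-(B_{\rm red}+[b_{\rm shunt}])$ is an $M$-matrix, and (ii) $I_{\rm shunt}>B_{\rm red}E_L^*$ component-wise. Then the reduced power flow equation $$\mathbf 0_n=Q_L^{\rm ZI}(E_L)+[E_L]B_{\rm red}(E_L-E_L^* )$$ has a unique solution $E_L^{\rm ZI}\in\mathbb{R}^n_{>0}$, given by $$E_L^{\rm ZI}=(B_{\rm red}+[b_{\rm shunt}])^{-1}(B_{\rm red}E_L^*-I_{\rm shunt}),$$ and the associated equilibrium point $(E_L^{\rm ZI},E_I^{\rm ZI})$, with $E_I^{\rm ZI}=W_2\begin{pmatrix}E_L^{\rm ZI}\\ E_I^*\end{pmatrix}$, of the closed-loop differential-algebraic system $$\begin{pmatrix}\mathbf 0_n\\ \tau_I\dot E_I\end{pmatrix}=\begin{pmatrix}Q_L^{\rm ZI}(E_L)\\ [E_I]K_I(E_I-E_I^* )\end{pmatrix}+[E]BE,\qquad E=(E_L,E_I),$$ is locally exponentially stable.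
   Context: Network: $n,m\ge 1$ are integers, $\mathcal L=\{1,\dots,n\}$ is the set of load buses, $\mathcal I=\{n+1,\dots,n+m\}$ the set of inverter buses, and $G$ is a connected undirected weighted graph on $\mathcal L\cup\mathcal I$ with edge set $\mathcal E$. The susceptance matrix $B\in\mathbb{R}^{(n+m)\times(n+m)}$ is symmetric with $B_{ij}=B_{ji}>0$ if $\{i,j\}\in\mathcal E$, $B_{ij}=0$ for $i\neq j$ with $\{i,j\}\notin\mathcal E$, and $B_{ii}=-\sum_{j\ne i}B_{ij}$. For a vector $x$, $[x]$ is the diagonal matrix with $x$ on the diagonal; $\mathbf 0_n$ is the zero vector. Block partition according to loads and inverters: $E=(E_L,E_I)$ and $B=\begin{pmatrix}B_{LL}&B_{LI}\\ B_{IL}&B_{II}\end{pmatrix}$. The diagonal matrix $K_I=\mathrm{diag}(K_i)_{i\in\mathcal I}$ contains controller gains $K_i<0$, $\tau_I=\mathrm{diag}(\tau_i)_{i\in\mathcal I}$ time constants $\tau_i>0$, and $E_I^*=(E_i^* )_{i\in\mathcal I}\in\mathbb{R}^m_{>0}$ voltage set points. Define $$B_{\rm red}=B_{LL}-B_{LI}(B_{II}+K_I)^{-1}B_{IL},\qquad W_1=-B_{\rm red}^{-1}B_{LI}(B_{II}+K_I)^{-1}K_I,$$ $$W_2=(B_{II}+K_I)^{-1}\begin{pmatrix}-B_{IL}&K_I\end{pmatrix},\qquad E_L^*=W_1E_I^*.$$ (The inverses exist.) A real square matrix $A$ is an $M$-matrix if $A_{ij}\le0$ for all $i\ne j$ and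 all eigenvalues of $A$ have positive real parts. An equilibrium of a differential-algebraic system is locally exponentially stable if there are $\delta,c,\lambda>0$ such that from every initial condition satisfying the algebraic equations and at distance less than $\delta$ from the equilibrium there is a unique continuous solution for all $t\ge0$, and its distance to the equilibrium at time $t$ is at most $c\,e^{-\lambda t}$ times the initial distance. *)

(* Defs.v *)
From HB Require Import structures.
From mathcomp Require Import all_boot all_order all_algebra.
From mathcomp Require Import all_classical all_reals all_analysis.
From mathcomp.real_closed Require Import complex.

Set Implicit Arguments.
Unset Strict Implicit.
Unset Printing Implicit Defensive.

Import Order.TTheory GRing.Theory Num.Theory.
Import numFieldNormedType.Exports.
Local Open Scope classical_set_scope.
Local Open Scope ring_scope.

Section Matrices.
Context {R : realType}.

(* [x] in the usual notation; [diag_mx] expects a row vector. *)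
Definition diagv {k : nat} (x : 'cV[R]_k) : 'M[R]_k := diag_mx x^T.

Definition positive {k : nat} (x : 'cV[R]_k) : Prop := forall i, 0 < x i 0.

Definition M_matrix {k : nat} (A : 'M[R]_k) : Prop :=
  (forall i j, i != j -> A i j <= 0) /\
  (forall z : R[i], eigenvalue (map_mx (real_complex R) A) z ->
     0 < complex.Re z).

End Matrices.

Definition connected_graph {V : finType} (edge : rel V) : Prop :=
  [/\ symmetric edge, irreflexive edge & forall i j, connect edge i j].

Definition susceptance_matrix {R : realType} {k : nat}
    (edge : rel 'I_k) (B : 'M[R]_k) : Prop :=
  [/\ forall i j, B i j = B j i,
      forall i j, edge i j -> 0 < B i j,
      forall i j, i != j -> ~~ edge i j -> B i j = 0 &
      forall i, B i i = - \sum_(j < k | j != i) B i j].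

(* Buses are indexed by 'I_(n + m): loads first, then inverters.  The gains K,
   the time constants tau and the set points Es are vectors over inverters. *)
Section Network.
Context {R : realType} {n m : nat}.
Implicit Types (B : 'M[R]_(n + m)) (K tau Es : 'cV[R]_m).
Implicit Types (EL EsL : 'cV[R]_n) (E : 'cV[R]_(n + m)).

Definition B_LL B : 'M[R]_n := ulsubmx B.
Definition B_LI B : 'M[R]_(n, m) := ursubmx B.
Definition B_IL B : 'M[R]_(m, n) := dlsubmx B.
Definition B_II B : 'M[R]_m := drsubmx B.

Definition B_red B K : 'M[R]_n :=
  B_LL B - B_LI B *m invmx (B_II B + diagv K) *m B_IL B.

Definition W1 B K : 'M[R]_(n, m) :=
  - (invmx (B_red B K) *m B_LI B *m invmx (B_II B + diagv K) *m diagv K).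

Definition W2 B K : 'M[R]_(m, n + m) :=
  invmx (B_II B + diagv K) *m row_mx (- B_IL B) (diagv K).

Definition E_Lstar B K Es : 'cV[R]_n := W1 B K *m Es.

Definition Q_ZI (b Ish : 'cV[R]_n) EL : 'cV[R]_n :=
  diagv EL *m diagv b *m EL + diagv EL *m Ish.

Definition reduced_power_flow B K Es (Q : 'cV[R]_n -> 'cV[R]_n) EL : Prop :=
  0 = Q EL + diagv EL *m B_red B K *m (EL - E_Lstar B K Es).

(* Right-hand side of the closed loop: the first n components are the
   algebraic equations, the last m ones give tau * dE_I/dt. *)
Definition closed_loop B K Es (Q : 'cV[R]_n -> 'cV[R]_n) E : 'cV[R]_(n + m) :=
  col_mx (Q (usubmx E))
         (diagv (dsubmx E) *m diagv K *m (dsubmx E - Es))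
  + diagv E *m B *m E.

End Network.

(* Systems (0, tau * dE_I/dt) = F (E), with E = (E_L, E_I). *)
Section DAE.
Context {R : realType} {n m : nat}.
Variables (tau : 'cV[R]_m) (F : 'cV[R]_(n + m) -> 'cV[R]_(n + m)).

(* Solutions are continuous on [0, +oo[; their values at negative times are
   irrelevant.  The differential equation is imposed for t > 0; if F is
   continuous, the one-sided equation at t = 0 then follows by the mean value
   theorem. *)
Definition dae_solution (E : R -> 'cV[R]_(n + m)) : Prop :=
  let EI := fun t => dsubmx (E t) in
  [/\ {within `[0, +oo[, continuous E},
      forall t, 0 <= t -> usubmx (F (E t)) = 0 &
      forall t, 0 < t ->
        derivable EI t 1 /\ diagv tau *m derive1 EI t = dsubmx (F (E t))].

Definition dae_equilibrium (Eeq : 'cV[R]_(n + m)) : Prop := F Eeq = 0.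

(* Distances are in the max norm; in finite dimension the notion does not
   depend on the norm. *)
Definition locally_exponentially_stable (Eeq : 'cV[R]_(n + m)) : Prop :=
  exists delta c lambda : R, [/\ 0 < delta, 0 < c, 0 < lambda &
    forall E0 : 'cV[R]_(n + m),
      usubmx (F E0) = 0 -> `|E0 - Eeq| < delta ->
      exists E : R -> 'cV[R]_(n + m),
        [/\ dae_solution E,
            E 0 = E0,
            forall E', dae_solution E' -> E' 0 = E0 ->
              forall t, 0 <= t -> E' t = E t &
            forall t, 0 <= t ->
              `|E t - Eeq| <= c * expR (- (lambda * t)) * `|E0 - Eeq|]].

End DAE.

(* Main.v *)
Require Import Defs.
From HB Require Import structures.
From mathcomp Require Import all_boot all_order all_algebra.
From mathcomp Require Import all_classical all_reals all_analysis.
From mathcomp Require Import spectral.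
From mathcomp.real_closed Require Import complex.
From mathcomp Require Import ring lra.

Set Implicit Arguments.
Unset Strict Implicit.
Unset Printing Implicit Defensive.

Import Order.TTheory GRing.Theory Num.Theory.
Import numFieldNormedType.Exports.
Local Open Scope ring_scope.

(** Let [S] be minus the matrix obtained from [B] by adding [b] and [K] to the
    diagonal, and let [e] be the claimed equilibrium. The right-hand side of the
    closed loop equals [- [E] S (E - e)] ([closed_loop_state_field]), so the
    theorem comes down to [S] being symmetric positive definite and [e] being
    positive.

    Without shunts, [S] is a graph Laplacian grounded at the inverters, and
    connectedness makes it positive definite ([posdef_grounded_laplacian]); its
    Schur complement with respect to the inverters is [- B_red], which is
    therefore invertible. With shunts the same Schur complement is
    [- (B_red + [b])], a symmetric M-matrix, hence positive definite by the
    spectral theorem ([M_matrix_posdef]); as the inverter block is positive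
    definite too, so is [S] ([posdef_schurP], [shunt_posdefP]). The equations for
    the loads, and then those for the inverters, have a positive right-hand side
    and a positive definite matrix with nonpositive off-diagonal entries, so
    their solutions are positive ([stieltjes_gt0]).

    For the stability, write [P] for the Schur complement of [S] with respect to
    the loads. Near [e] the load voltages are positive, so that the algebraic
    equations are linear and say that [E - e] is the lift [H x] of the deviation
    [x] of the inverter voltages ([algebraic_lift]). What remains is the system
    [tau_i x_i' = - (e_i + x_i) (P x)_i] of Lotka-Volterra type, for which
    [V = x^T P x] has derivative [- 2 sum_i (e_i + x_i) / tau_i (P x)_i ^ 2].
    Since [V] is at most a multiple of [|P x|^2] and comparable with [|x|^2], it
    decays exponentially ([trunc_qform_decay]).

    Global existence and uniqueness come from clipping both factors of the
    vector field. The clipped field is globally Lipschitz, so Picard iteration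
    applies ([ode_exists], [ode_unique]), and [V] still decreases along its
    solutions; these stay so close to [0] that the clipping is never active, and
    they solve the original system. Any other solution with the same initial
    value coincides with this one as long as it stays near [e], so it has no
    first exit time from a small ball ([first_exit]) and coincides with it
    forever ([posdef_stable]). *)

(** * Positive definite matrices and Schur complements *)

Section PositiveDefinite.
Context {R : realType}.

Lemma addmxE m n (A B : 'M[R]_(m, n)) i j : (A + B) i j = A i j + B i j.
Proof. by rewrite mxE. Qed.

Lemma submxE m n (A B : 'M[R]_(m, n)) i j : (A - B) i j = A i j - B i j.
Proof. by rewrite !mxE. Qed.

Lemma scalemxE m n (a : R) (A : 'M[R]_(m, n)) i j : (a *: A) i j = a * A i j.
Proof. by rewrite mxE. Qed.

Lemma mulcvE m n (A : 'M[R]_(m, n)) (x : 'cV[R]_n) i :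
  (A *m x) i 0 = \sum_j A i j * x j 0.
Proof. by rewrite mxE. Qed.

Lemma oppmxE m n (A : 'M[R]_(m, n)) i j : (- A) i j = - A i j.
Proof. by rewrite mxE. Qed.

Lemma mul_diagvE k (d x : 'cV[R]_k) i : (diagv d *m x) i 0 = d i 0 * x i 0.
Proof. by rewrite mul_diag_mx !mxE. Qed.

Definition qform {k} (P : 'M[R]_k) (x : 'cV[R]_k) : R := (x^T *m P *m x) 0 0.

Definition posdef {k} (P : 'M[R]_k) : Prop :=
  P^T = P /\ forall x, x != 0 -> 0 < qform P x.

Definition offdiag_le0 {k} (P : 'M[R]_k) : Prop :=
  forall i j, i != j -> P i j <= 0.

Lemma bilinE k (P : 'M[R]_k) (x y : 'cV[R]_k) :
  (x^T *m P *m y) 0 0 = \sum_i x i 0 * (P *m y) i 0.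
Proof. by rewrite -mulmxA mxE; apply: eq_bigr => i _; rewrite mxE. Qed.

Lemma qformE k (P : 'M[R]_k) x : qform P x = \sum_i x i 0 * (P *m x) i 0.
Proof. exact: bilinE. Qed.

Lemma posdef_ge0 k (P : 'M[R]_k) x : posdef P -> 0 <= qform P x.
Proof.
move=> [_ Ppos]; have [->|/Ppos/ltW//] := eqVneq x 0.
by rewrite /qform mulmx0 mxE.
Qed.

Lemma posdef_unitmx k (P : 'M[R]_k) : posdef P -> P \in unitmx.
Proof.
move=> [_ Ppos]; rewrite -row_free_unit -kermx_eq0.
apply/negPn/negP => /rowV0Pn[v /sub_kermxP vP v0].
have /Ppos : v^T != 0 by rewrite trmx_eq0.
by rewrite /qform trmxK vP mul0mx mxE ltxx.
Qed.

Lemma mulmx_symC k (P : 'M[R]_k) (x y : 'cV[R]_k) : P^T = P ->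
  (y^T *m P *m x) 0 0 = (x^T *m P *m y) 0 0.
Proof.
move=> Ps; transitivity ((x^T *m P *m y)^T 0 0); last by rewrite mxE.
by rewrite !trmx_mul trmxK Ps mulmxA.
Qed.

Lemma qform_subZ k (P : 'M[R]_k) (x y : 'cV[R]_k) (a : R) : P^T = P ->
  qform P (x - a *: y)
  = qform P x - 2 * a * (x^T *m P *m y) 0 0 + a ^+ 2 * qform P y.
Proof.
move=> Ps; have yx := mulmx_symC x y Ps.
have tr : (x - a *: y)^T = x^T - a *: y^T by apply/matrixP => i j; rewrite !mxE.
rewrite /qform tr !(mulmxBl, mulmxBr).
rewrite -!(scalemxAl, scalemxAr).
rewrite !(submxE, scalemxE) yx; ring.
Qed.

(** Cauchy-Schwarz for the inner product of [P], applied to [x] and to the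
    vector [invmx P e_i] that represents the [i]-th coordinate. *)
Lemma posdef_coord k (P : 'M[R]_k) (x : 'cV[R]_k) i : posdef P ->
  x i 0 ^+ 2 <= invmx P i i * qform P x.
Proof.
move=> Ppd; have Pu := posdef_unitmx Ppd.
pose w := invmx P *m delta_mx i 0 : 'cV[R]_k.
have Pw : P *m w = delta_mx i 0 by rewrite mulKVmx.
have coordE (z : 'cV[R]_k) : (z^T *m P *m w) 0 0 = z i 0.
  rewrite -mulmxA Pw mxE (bigD1 i)//= !mxE !eqxx mulr1 big1 ?addr0// => j ji.
  by rewrite !mxE (negbTE ji) mulr0.
have wE : qform P w = invmx P i i.
  rewrite /qform coordE mxE (bigD1 i)//= !mxE !eqxx mulr1 big1 ?addr0// => j ji.
  by rewrite !mxE (negbTE ji) mulr0.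
have w0 : w != 0.
  apply: contraTneq (oner_neq0 R) => w0; rewrite negbK.
  by move/matrixP : Pw => /(_ i 0); rewrite w0 mulmx0 !mxE !eqxx => /esym/eqP.
have s0 := Ppd.2 _ w0; rewrite wE in s0.
have := posdef_ge0 (x - (x i 0 / invmx P i i) *: w) Ppd.
rewrite (qform_subZ _ _ _ Ppd.1) coordE wE.
set s := invmx P i i in s0 *; set V := qform P x.
have -> : V - 2 * (x i 0 / s) * x i 0 + (x i 0 / s) ^+ 2 * s
  = V - x i 0 ^+ 2 / s by field; rewrite gt_eqF.
by rewrite subr_ge0 ler_pdivrMr// mulrC.
Qed.

(** A Stieltjes matrix is inverse positive: pairing [P x] with the negative
    part [y] of [x] gives [qform P y <= 0], because [y] and the positive part
    have disjoint supports and the off-diagonal entries of [P] are [<= 0]. *)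
Lemma stieltjes_gt0 k (P : 'M[R]_k) (x : 'cV[R]_k) :
  posdef P -> offdiag_le0 P -> positive (P *m x) -> positive x.
Proof.
move=> Ppd Poff Px.
pose y : 'cV[R]_k := \col_i Num.max 0 (- x i 0).
pose z : 'cV[R]_k := x + y.
have y_ge0 i : 0 <= y i 0 by rewrite mxE le_max lexx.
have z_ge0 i : 0 <= z i 0.
  by rewrite !mxE -lerBlDl sub0r le_max lexx orbT.
have yz i : y i 0 * z i 0 = 0.
  rewrite !mxE; case: (leP 0 (- x i 0)) => _; last by rewrite mul0r.
  by rewrite subrr mulr0.
have Py i : (P *m y) i 0 = (P *m z) i 0 - (P *m x) i 0.
  by rewrite /z mulmxDr addmxE addrAC subrr add0r.
have y0 : y = 0.
  apply: contraTeq isT => /Ppd.2; rewrite qformE ltNge => /negP[].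
  apply: sumr_le0 => i _.
  rewrite Py mulrBr subr_le0.
  apply: (@le_trans _ _ 0); last by rewrite mulr_ge0// ltW.
  rewrite mulcvE mulr_sumr; apply: sumr_le0 => j _.
  have [<-|ij] := eqVneq i j; first by rewrite mulrCA yz mulr0.
  by rewrite mulrCA mulr_le0_ge0 ?Poff// mulr_ge0.
have x_ge0 i : 0 <= x i 0.
  by have := z_ge0 i; rewrite /z y0 addr0.
move=> i; rewrite lt_neqAle x_ge0 andbT eq_sym.
apply: contraTneq (Px i) => xi0; rewrite -leNgt mxE.
apply: sumr_le0 => j _; have [<-|ij] := eqVneq i j; first by rewrite xi0 mulr0.
by rewrite mulr_le0_ge0// Poff.
Qed.

Lemma qform_block n m (A : 'M[R]_n) (C : 'M[R]_(n, m)) (D : 'M[R]_m) x y :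
  qform (block_mx A C C^T D) (col_mx x y)
  = qform A x + 2 * (x^T *m C *m y) 0 0 + qform D y.
Proof.
rewrite /qform tr_col_mx mul_row_block mul_row_col !mulmxDl.
have -> : y^T *m C^T *m x = (x^T *m C *m y)^T.
  by rewrite !trmx_mul trmxK mulmxA.
rewrite !addmxE [(_^T) 0 0]mxE; ring.
Qed.

(** Exchanging the blocks gives access to the Schur complement of [A]. *)
Lemma posdef_blockC n m (A : 'M[R]_n) (C : 'M[R]_(n, m)) (D : 'M[R]_m) :
  posdef (block_mx A C C^T D) -> posdef (block_mx D C^T C A).
Proof.
move=> [Ss Sp]; split.
  move: Ss; rewrite !tr_block_mx trmxK => /eq_block_mx[-> _ _ ->] //.
move=> z; rewrite -(vsubmxK z); set x := usubmx z; set y := dsubmx z => z0.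
have /Sp : col_mx y x != 0.
  by apply: contraNneq z0 => /eqP; rewrite !col_mx_eq0 andbC.
rewrite qform_block -[X in block_mx _ _ X _]trmxK qform_block.
have -> : (x^T *m C^T *m y) 0 0 = (y^T *m C *m x) 0 0.
  transitivity ((y^T *m C *m x)^T 0 0); last by rewrite mxE.
  by rewrite !trmx_mul trmxK mulmxA.
by lra.
Qed.

Lemma posdef_block_dr n m (A : 'M[R]_n) (C : 'M[R]_(n, m)) (D : 'M[R]_m) :
  posdef (block_mx A C C^T D) -> posdef D.
Proof.
move=> [Ss Sp]; split.
  by move: Ss; rewrite tr_block_mx => /eq_block_mx[].
move=> y y0; have := Sp (col_mx 0 y); rewrite qform_block.
rewrite /qform trmx0 !mul0mx !mxE mulr0 !add0r; apply.
by rewrite col_mx_eq0 (negbTE y0) andbF.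
Qed.

(** The Schur complement of [D] in [block_mx A C C^T D]. *)
Definition schur n m (A : 'M[R]_n) (C : 'M[R]_(n, m)) (D : 'M[R]_m) :=
  A - C *m invmx D *m C^T.

(** Completing the square in the second block. *)
Lemma qform_schur n m (A : 'M[R]_n) (C : 'M[R]_(n, m)) (D : 'M[R]_m) x y :
  D \in unitmx -> D^T = D ->
  qform (block_mx A C C^T D) (col_mx x y)
  = qform (schur A C D) x + qform D (y + invmx D *m C^T *m x).
Proof.
move=> Du Ds; have iDs : (invmx D)^T = invmx D by rewrite trmx_inv Ds.
rewrite qform_block /schur -[_ + _ *m x]opprK opprD -[- (_ *m x)]scaleN1r.
rewrite scaleN1r.
have -> : - (- y - invmx D *m C^T *m x) = y - (-1) *: (invmx D *m C^T *m x).
  by rewrite opprD !opprK scaleN1r opprK.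
rewrite qform_subZ// /qform mulmxBr mulmxBl.
have -> : y^T *m D *m (invmx D *m C^T *m x) = (x^T *m C *m y)^T.
  by rewrite !trmx_mul trmxK !mulmxA mulmxK.
have -> : (invmx D *m C^T *m x)^T *m D *m (invmx D *m C^T *m x)
   = x^T *m (C *m invmx D *m C^T) *m x.
  by rewrite !trmx_mul trmxK iDs !mulmxA mulmxKV.
rewrite submxE [(_^T) 0 0]mxE; ring.
Qed.

Lemma posdef_schurP n m (A : 'M[R]_n) (C : 'M[R]_(n, m)) (D : 'M[R]_m) :
  posdef (block_mx A C C^T D) <-> posdef D /\ posdef (schur A C D).
Proof.
split=> [Spd|[Dpd [Ss Sp]]].
  have Dpd := posdef_block_dr Spd; have Du := posdef_unitmx Dpd.
  have [Ds _] := Dpd; have [Ss Sp] := Spd; split=> //; split.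
    move: Ss; rewrite tr_block_mx => /eq_block_mx[As _ _ _].
    by rewrite /schur linearB/= !trmx_mul trmxK trmx_inv Ds As mulmxA.
  move=> x x0; have := Sp (col_mx x (- (invmx D *m C^T *m x))).
  rewrite qform_schur// addNr [qform D 0]/qform mulmx0 mxE addr0; apply.
  by rewrite col_mx_eq0 (negbTE x0).
have Du := posdef_unitmx Dpd; have [Ds Dp] := Dpd; split.
  rewrite tr_block_mx trmxK Ds; congr block_mx.
  move: Ss; rewrite /schur linearB/= !trmx_mul trmxK trmx_inv Ds mulmxA.
  by move=> /addIr.
move=> z; rewrite -(vsubmxK z); set x := usubmx z; set y := dsubmx z => z0.
rewrite qform_schur//; have [x0|x0] := eqVneq x 0.
  rewrite x0 mulmx0 addr0 [qform (schur _ _ _) 0]/qform mulmx0 mxE add0r.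
  by apply: Dp; apply: contraNneq z0 => y0; rewrite x0 y0 col_mx0.
by rewrite ltr_pwDl ?Sp// posdef_ge0.
Qed.

End PositiveDefinite.

(** * Symmetric M-matrices and grounded Laplacians *)

Section Spectrum.
Local Open Scope sesquilinear_scope.
Context {R : realType}.

(** Diagonalise [A] over [R[i]] in a unitary basis [U]: the eigenvalues [d] are
    real because [A] is symmetric, hence positive by hypothesis, and
    [qform A x] is the combination of the [|(U x)_i|^2] with weights [d_i]. *)
Lemma M_matrix_posdef k (A : 'M[R]_k) : A^T = A -> M_matrix A -> posdef A.
Proof.
move=> As [_ Aeig]; split=> // x x0.
set toC := real_complex R; pose Ac := map_mx toC A.
have Aherm : Ac \is hermsymmx.
  apply: realsym_hermsym.
    apply/is_hermitianmxP; rewrite expr0 scale1r map_mx_id//.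
    by apply/matrixP => i j; rewrite !mxE -[in LHS]As mxE.
  apply/mxOverP => i j; rewrite mxE.
  by rewrite complex_real.
have /orthomx_spectralP AE := hermitian_normalmx Aherm.
have dreal := hermitian_spectral_diag_real Aherm.
have Uu := spectral_unitarymx Ac.
move: (spectralmx Ac) (spectral_diag Ac) AE dreal Uu => U d.
move=> AE dreal Uunitary; have Uunit := unitarymx_unit Uunitary.
have d_gt0 i : 0 < d 0 i.
  have di : complex.Im (d 0 i) = 0.
    have /mxOverP /(_ 0 i) := dreal.
    by case: (d 0 i) => a b; rewrite complex_real => /eqP.
  rewrite ltcE di eqxx /=; apply: Aeig; apply/eigenvalueP.
  exists (row i U).
    rewrite -/toC -/Ac AE -row_mul mulmxA mulmxA mulmxV// mul1mx.
    by rewrite row_mul row_diag_mx -scalemxAl -rowE.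
  apply: contraTneq Uunit => U0; rewrite unitmxE (expand_det_row _ i) big1 ?unitr0//.
  by move=> j _; have /rowP/(_ j) := U0; rewrite !mxE => ->; rewrite mul0r.
pose u := map_mx toC x; pose v := U *m u.
have v0 : v != 0.
  apply: contraNneq x0 => /(congr1 (mulmx (invmx U))).
  rewrite mulKmx// mulmx0 => u0; apply/eqP/matrixP => i j.
  move/matrixP : u0 => /(_ i j); rewrite !mxE => -[]//.
have qE : toC (qform A x) = \sum_i d 0 i * `|v i 0| ^+ 2.
  have -> : toC (qform A x) = (u^T *m Ac *m u) 0 0.
    by rewrite /u /Ac map_trmx -!map_mxM mxE.
  have uU : u^T *m U^t* = v^t*.
    have -> : u^T = u^t*.
      by apply/matrixP => i j; rewrite !mxE; apply/esym/CrealP; rewrite complex_real.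
    by rewrite -map_mxM -trmx_mul.
  have -> : u^T *m Ac *m u = v^t* *m (diag_mx d *m v).
    rewrite AE (invmx_unitary Uunitary) -uU /v.
    rewrite -!mulmxA; reflexivity.
  rewrite mxE; apply: eq_bigr => i _.
  rewrite mul_diag_mx !mxE mulrCA; congr (_ * _).
  by rewrite normCK mulrC.
have : 0 < toC (qform A x).
  rewrite qE; have [i vi0] : exists i, v i 0 != 0.
    apply/existsP; apply: contraNT v0; rewrite negb_exists => /forallP v0.
    apply/eqP/matrixP => i j; rewrite ord1 [RHS]mxE; apply/eqP.
    by have := v0 i; rewrite negbK.
  rewrite (bigD1 i)//=; apply: ltr_pwDl.
    by apply: mulr_gt0; [exact: d_gt0|rewrite exprn_gt0// normr_gt0].
  by apply: sumr_ge0 => j _; rewrite mulr_ge0 ?exprn_ge0// ltW.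
by rewrite (ltcR 0).
Qed.

End Spectrum.

Section Laplacian.
Context {R : realType}.

(** Since the rows of [B] sum to [0], the form is
    [sum_(i, j) B_ij (x_i - x_j) ^ 2 / 2 - sum_i kappa_i x_i ^ 2]. Where it
    vanishes, [x] is constant along edges, hence constant by connectedness, and
    [x] is [0] at [i0]. *)
Lemma posdef_grounded_laplacian k (edge : rel 'I_k) (B : 'M[R]_k)
    (kappa : 'cV[R]_k) (i0 : 'I_k) :
  connected_graph edge -> susceptance_matrix edge B ->
  (forall i, kappa i 0 <= 0) -> kappa i0 0 < 0 ->
  posdef (- (B + diagv kappa)).
Proof.
move=> [_ _ conn] [Bsym Bpos B0 Bdiag] kle0 ki0.
have BT : B^T = B by apply/matrixP => i j; rewrite mxE Bsym.
split=> [|x x0].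
  by rewrite linearN linearD /= BT tr_diag_mx.
have B_ge0 i j : i != j -> 0 <= B i j.
  by move=> ij; have [/Bpos/ltW//|/B0->//] := boolP (edge i j).
have Brow i : \sum_j B i j = 0 by rewrite (bigD1 i)//= Bdiag addNr.
pose w i j := B i j * (x i 0 - x j 0) ^+ 2.
have w_ge0 i j : 0 <= w i j.
  have [<-|ij] := eqVneq i j; first by rewrite /w subrr expr0n mulr0.
  by rewrite mulr_ge0 ?B_ge0// sqr_ge0.
have qE : qform (- (B + diagv kappa)) x
    = 2^-1 * (\sum_i \sum_j w i j) + \sum_i - kappa i 0 * x i 0 ^+ 2.
  have -> : \sum_i \sum_j w i j = - 2 * \sum_i x i 0 * \sum_j B i j * x j 0.
    transitivity (\sum_i x i 0 ^+ 2 * (\sum_j B i j)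
        + \sum_j x j 0 ^+ 2 * (\sum_i B j i)
        - 2 * \sum_i x i 0 * \sum_j B i j * x j 0); last first.
      by under eq_bigr do rewrite Brow mulr0; rewrite big1// !add0r mulNr.
    under [X in _ + X - _]eq_bigr do rewrite mulr_sumr.
    rewrite [X in _ + X - _]exchange_big /= mulr_sumr -sumrN -!big_split /=.
    apply: eq_bigr => i _; rewrite !mulr_sumr -sumrN -!big_split /=.
    by apply: eq_bigr => j _; rewrite /w (Bsym j i); ring.
  rewrite mulrA (_ : 2^-1 * -2 = -1) ?mulN1r; last by lra.
  rewrite qformE -sumrN -big_split /=; apply: eq_bigr => i _.
  rewrite mulNmx mulmxDl oppmxE addmxE mulcvE mul_diagvE; ring.
have k_ge0 i : 0 <= - kappa i 0 * x i 0 ^+ 2.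
  by rewrite mulr_ge0 ?sqr_ge0// oppr_ge0.
have s1 : 0 <= 2^-1 * (\sum_i \sum_j w i j).
  by rewrite mulr_ge0 ?invr_ge0//; do 2![apply: sumr_ge0 => ? _].
have s2 : 0 <= \sum_i - kappa i 0 * x i 0 ^+ 2 by apply: sumr_ge0.
rewrite lt_neqAle qE addr_ge0// andbT eq_sym; apply: contraNneq x0 => /eqP.
rewrite paddr_eq0// mulf_eq0 invr_eq0 pnatr_eq0 /= => /andP[/eqP w0 /eqP kx0].
have wij0 i j : w i j = 0.
  have := w0; move/psumr_eq0P => /(_ (fun i _ => sumr_ge0 _ (fun j _ => w_ge0 i j))).
  by move=> /(_ i isT)/psumr_eq0P; apply.
have xi0 : x i0 0 = 0.
  move/psumr_eq0P : kx0 => /(_ (fun i _ => k_ge0 i) i0 isT) /eqP.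
  by rewrite mulf_eq0 oppr_eq0 (lt_eqF ki0) /= sqrf_eq0 => /eqP.
have xE i j : edge i j -> x i 0 = x j 0.
  move=> eij; have /eqP := wij0 i j.
  by rewrite mulf_eq0 (gt_eqF (Bpos _ _ eij)) /= sqrf_eq0 subr_eq0 => /eqP.
apply/eqP/matrixP => j ?; rewrite ord1 mxE -xi0.
have /connectP[p] := conn i0 j; elim: p i0 {ki0 xi0} => [|a p IH] i /=.
  by move=> _ ->.
by move=> /andP[/xE ->]; exact: IH.
Qed.

End Laplacian.

(** * Continuous curves and their derivatives *)

Section RealAnalysis.
Context {R : realType}.
Local Open Scope classical_set_scope.

(* Curves on the half-line [0 <= t] are made total by precomposing them with
   the positive part, so that continuity can be used on the whole line. *)
Notation "0^+ t" := (Num.max 0 t) (at level 2, t at level 1).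

Lemma max0_id (t : R) : 0 <= t -> 0^+ t = t.
Proof. by move=> t0; rewrite max_r. Qed.

Lemma max0_ge0 (t : R) : 0 <= 0^+ t.
Proof. by rewrite le_max lexx. Qed.

Lemma continuous_max0 : continuous (fun t : R => 0^+ t).
Proof.
move=> t; have := @continuous_max R R (fun=> 0) id t; apply.
  exact: cst_continuous.
by move=> A.
Qed.

Lemma within_continuous_max0 (T : topologicalType) (x : R -> T) :
  {within `[0, +oo[, continuous x} -> continuous (fun t : R => x (0^+ t)).
Proof.
move=> xc t; have t0 := max0_ge0 t.
have /subspace_continuousP/(_ (0^+ t)) := xc.
rewrite /= in_itv/= andbT => /(_ t0) xt; apply: cvg_trans xt => A.
move=> [r /= r0 rA].
have [d /= d0 dA] := (cvgrPdist_lt _ _).1 (@continuous_max0 t) _ r0.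
exists d => //= s /dA ts; apply: rA => //=.
by rewrite in_itv/= max0_ge0.
Qed.

Lemma derive_le0_le (T : R) (f df : R -> R) : 0 <= T -> continuous f ->
  (forall t : R, 0 < t < T -> is_derive t 1 f (df t)) ->
  (forall t : R, 0 < t < T -> df t <= 0) -> f T <= f 0.
Proof.
move=> T0 fc fd df0; have [->//|T_neq0] := eqVneq T 0.
have T_gt0 : 0 < T by rewrite lt_neqAle eq_sym T_neq0.
have fd' t : t \in `]0, T[%R -> is_derive t 1 f (df t).
  by rewrite in_itv; exact: fd.
have [|c] := MVT T_gt0 fd'; first exact: continuous_subspaceT.
rewrite in_itv => /df0 c0 /eqP; rewrite subr_eq => /eqP ->.
by rewrite subr0 gerDr mulr_le0_ge0.
Qed.

(** A mean value inequality: [f - h] and [- f - h] are nonincreasing. *)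
Lemma derive_norm_le (T : R) (f df h dh : R -> R) : 0 <= T ->
  continuous f -> continuous h ->
  (forall t : R, 0 < t < T -> is_derive t 1 f (df t)) ->
  (forall t : R, 0 < t < T -> is_derive t 1 h (dh t)) ->
  (forall t : R, 0 < t < T -> `|df t| <= dh t) -> `|f 0| <= h 0 -> `|f T| <= h T.
Proof.
move=> T0 fc hc fd hd dfh f0; move: f0; rewrite !ler_norml => /andP[fl fr].
apply/andP; split.
  suff : (- f - h) T <= (- f - h) 0 by rewrite !fctE; lra.
  apply: (@derive_le0_le _ _ (fun t => - df t - dh t)) => //.
  - by move=> t; apply: continuousB; [apply: continuousN; exact: fc|exact: hc].
  - by move=> t tT; apply: is_deriveB; [apply: is_deriveN; exact: fd|exact: hd].
  - by move=> t /dfh; rewrite ler_norml => /andP[]; lra.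
suff : (f - h) T <= (f - h) 0 by rewrite !fctE; lra.
apply: (@derive_le0_le _ _ (fun t => df t - dh t)) => //.
- by move=> t; apply: continuousB; [exact: fc|exact: hc].
- by move=> t tT; apply: is_deriveB; [exact: fd|exact: hd].
- by move=> t /dfh; rewrite ler_norml => /andP[]; lra.
Qed.

(** Integrating from [-1] instead of [0] makes [0] an interior point of the
    domain, where the fundamental theorem of calculus applies. *)
Lemma antiderivative_exists (f : R -> R) : continuous f ->
  {F : R -> R | F 0 = 0 & forall t : R, 0 <= t -> is_derive t 1 F (f t)}.
Proof.
move=> fc.
pose I t := (\int[lebesgue_measure]_(s in [set` `[-1, t]]) f s)%R.
exists (I - cst (I 0)); first by rewrite !fctE subrr.
move=> t t0.
have [dI I'] : derivable I t 1 /\ I^`() t = f t.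
  apply: (@continuous_FTC1_closed R f (-1) t (t + 1)).
  - by rewrite ltrDl.
  - apply: continuous_compact_integrable; first exact: segment_compact.
    exact: continuous_subspaceT.
  - by rewrite (lt_le_trans _ t0)// oppr_lt0.
  - exact: fc.
rewrite -[f t]subr0; apply: is_deriveB.
by rewrite -I' derive1E; exact/derivableP.
Qed.

Lemma coord_le_norm k (x : 'cV[R]_k) i : `|x i 0| <= `|x|.
Proof.
rewrite [leRHS]/Num.Def.normr /= mx_normrE.
exact: (le_bigmax _ (fun ij => `|x ij.1 ij.2|) (i, 0)).
Qed.

Lemma norm_le_coord k (x : 'cV[R]_k) c : 0 <= c ->
  (forall i, `|x i 0| <= c) -> `|x| <= c.
Proof.
move=> c0 xc; rewrite [leLHS]/Num.Def.normr /= mx_normrE.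
by apply: bigmax_le => // -[i j] _; rewrite /= ord1.
Qed.

Lemma continuous_coord k (x : R -> 'cV[R]_k) i :
  continuous x -> continuous (fun t => x t i 0).
Proof.
move=> xc t; apply: (@continuous_comp _ _ _ x (fun v : 'cV[R]_k => v i 0)).
  exact: xc.
exact: coord_continuous.
Qed.

Lemma continuous_cV k (x : R -> 'cV[R]_k) :
  (forall i, continuous (fun t => x t i 0)) -> continuous x.
Proof.
move=> xc t; apply/cvgrPdist_le => /= e e0; near=> s.
apply: norm_le_coord; first exact: ltW.
move=> i; rewrite !mxE; move: i; near: s; apply: filter_forall => i.
exact: ((cvgrPdist_le _ _).1 (xc i t)).
Unshelve. all: by end_near. Qed.

Definition lipschitz_map k l (L : R) (g : 'cV[R]_k -> 'cV[R]_l) : Prop :=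
  forall x y, `|g x - g y| <= L * `|x - y|.

Lemma lipschitz_comp_continuous k l L (g : 'cV[R]_k -> 'cV[R]_l)
    (x : R -> 'cV[R]_k) : 0 < L -> lipschitz_map L g -> continuous x ->
  continuous (g \o x).
Proof.
move=> L0 gL xc t; apply/cvgrPdist_le => /= e e0; near=> s.
apply: (le_trans (gL _ _)); rewrite mulrC -ler_pdivlMr//; near: s.
by apply: ((cvgrPdist_le _ _).1 (xc t)); rewrite divr_gt0.
Unshelve. all: by end_near. Qed.

End RealAnalysis.

(** * Picard iteration for globally Lipschitz vector fields *)

Section ODE.
Context {R : realType}.
Local Open Scope classical_set_scope.

Lemma half_pow_small (c e : R) : 0 < e -> exists k, c * 2^-1 ^+ k < e.
Proof.
move=> e0; have h1 : `|2^-1 : R| < 1 by rewrite gtr0_norm ?invf_lt1// ltr1n.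
have ck : (c * 2^-1 ^+ k) @[k --> \oo] --> (0 : R).
  by rewrite -(mulr0 c); apply: cvgM; [exact: cvg_cst|exact: cvg_expr].
have [k _ /(_ k (leqnn k)) kE] := (cvgrPdist_lt _ _).1 ck _ e0; exists k.
by move: kE; rewrite /= sub0r normrN; exact/le_lt_trans/ler_norm.
Qed.

Lemma half_pow_le0 (c a : R) : (forall k, a <= c * 2^-1 ^+ k) -> a <= 0.
Proof.
move=> ac; rewrite leNgt; apply/negP => /(half_pow_small c)[k].
by rewrite ltNge ac.
Qed.

(** The sequences [u k -+ 2 c / 2 ^ k] are nested, so the supremum of the lower
    one lies between them. *)
Lemma geometric_cauchy (u : nat -> R) (c : R) :
  (forall k, `|u k.+1 - u k| <= c * 2^-1 ^+ k) ->
  exists l, forall k, `|u k - l| <= 2 * c * 2^-1 ^+ k.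
Proof.
move=> uc; pose r k := 2 * c * 2^-1 ^+ k; pose w k := u k - r k.
have c0 : 0 <= c by have := uc 0%N; rewrite expr0 mulr1; apply: le_trans.
have r0 k : 0 <= r k by rewrite !mulr_ge0// exprn_ge0// invr_ge0.
have rS k : r k = r k.+1 + c * 2^-1 ^+ k by rewrite /r exprS; field.
have wr k j : w j <= u k + r k.
  have up i : w i <= w i.+1.
    have := uc i; rewrite ler_norml /w (rS i) => /andP[+ _]; lra.
  have down i : u i.+1 + r i.+1 <= u i + r i.
    have := uc i; rewrite ler_norml (rS i) => /andP[_]; lra.
  have [jk|/ltnW kj] := leqP j k.
    apply: (@le_trans _ _ (w k)); last by rewrite /w; have := r0 k; lra.
    exact: (nondecreasing_seqP w).1 up _ _ jk.
  apply: (@le_trans _ _ (u j + r j)); first by rewrite /w; have := r0 j; lra.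
  exact: (nonincreasing_seqP (fun i => u i + r i)).1 down _ _ kj.
have ws : has_sup (range w).
  by split; [exists (w 0%N), 0%N|exists (u 0%N + r 0%N) => _ [j _ <-]; exact: wr].
exists (sup (range w)) => k; rewrite -/(r k) ler_distl; apply/andP; split.
  by rewrite lerBlDr; apply: (ge_sup ws.1) => _ [j _ <-]; exact: wr.
by rewrite -lerBlDr; apply: (ub_le_sup ws.2); exists k.
Qed.

Definition expo (a K t : R) := K * expR (a * t).

Lemma is_derive_expo (a K t : R) : is_derive t 1 (expo a K) (a * expo a K t).
Proof.
have -> : a * expo a K t = K *: (expR (a * t) * (a *: 1)).
  by rewrite /expo /GRing.scale /=; ring.
by apply: is_deriveZ; apply: (@is_derive1_comp _ expR (a \*: id) t).
Qed.

Lemma continuous_expo (a K : R) : continuous (expo a K).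
Proof.
move=> t; apply: differentiable_continuous; apply/derivable1_diffP.
by have [] := is_derive_expo a K t.
Qed.

Lemma expo_ge a K t : 0 <= a -> 0 <= K -> 0 <= t -> K <= expo a K t.
Proof.
move=> a0 K0 t0; rewrite /expo ler_peMr//.
by rewrite -expR0 ler_expR mulr_ge0.
Qed.

Lemma expoM a K b t : expo a (K * b) t = expo a K t * b.
Proof. by rewrite /expo mulrAC. Qed.

Lemma continuous_is_derive (f : R -> R) df (t : R) :
  is_derive t 1 f df -> {for t, continuous f}.
Proof.
by move=> [dft _]; apply: differentiable_continuous; apply/derivable1_diffP.
Qed.

Lemma primitive_exists k (h : R -> 'cV[R]_k) (x0 : 'cV[R]_k) : continuous h ->
  exists y : R -> 'cV[R]_k, [/\ continuous y, y 0 = x0,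
    forall t, y (Num.max 0 t) = y t &
    forall (t : R) i, 0 < t -> is_derive t 1 (fun s => y s i 0) (h t i 0)].
Proof.
move=> hc; pose P i := antiderivative_exists (continuous_coord (i := i) hc).
pose F i := s2val (P i).
have F0 i : F i 0 = 0 by exact: (s2valP (P i)).
have FE i (t : R) : 0 <= t -> is_derive t 1 (F i) (h t i 0).
  exact: (s2valP' (P i)).
pose y t : 'cV[R]_k := \col_i (x0 i 0 + F i (Num.max 0 t)).
exists y; split.
- apply: continuous_cV => i.
  have -> : (fun t => y t i 0) = cst (x0 i 0) + (F i \o Num.max 0).
    by apply/funext => t; rewrite mxE.
  move=> t; apply: continuousD; first exact: cst_continuous.
  apply: continuous_comp; first exact: continuous_max0.
  exact: continuous_is_derive (FE i _ (max0_ge0 t)).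
- by apply/matrixP => i j; rewrite ord1 mxE maxxx F0 addr0.
- by move=> t; apply/matrixP => i j; rewrite !mxE max0_id ?max0_ge0.
- move=> t i t0; rewrite -[h t i 0]add0r.
  apply: (near_eq_is_derive (f := cst (x0 i 0) + F i)).
    by near=> s; rewrite fctE mxE max0_id// ltW//; near: s; exact: lt_nbhsr.
  by apply: is_deriveD; apply: FE; exact: ltW.
Unshelve. all: by end_near. Qed.

Section Lipschitz.
Variables (k : nat) (g : 'cV[R]_k -> 'cV[R]_k) (L : R).
Hypotheses (L0 : 0 < L) (gL : lipschitz_map L g).

(** The weight [expR (2 * L * t)] makes the Picard operator halve distances. *)
Lemma picard_contraction (T K : R) (x1 x2 y1 y2 : R -> 'cV[R]_k) :
  0 <= K -> continuous y1 -> continuous y2 -> y1 0 = y2 0 ->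
  (forall t i, 0 < t < T -> is_derive t 1 (fun s => y1 s i 0) (g (x1 t) i 0)) ->
  (forall t i, 0 < t < T -> is_derive t 1 (fun s => y2 s i 0) (g (x2 t) i 0)) ->
  (forall t, 0 < t < T -> `|x1 t - x2 t| <= expo (2 * L) K t) ->
  forall t, 0 <= t <= T -> `|y1 t - y2 t| <= expo (2 * L) (K * 2^-1) t.
Proof.
move=> K0 y1c y2c y0 dy1 dy2 x12 t /andP[t0 tT].
have expo0 s : 0 <= expo (2 * L) (K * 2^-1) s.
  by rewrite mulr_ge0 ?expR_ge0// mulr_ge0// invr_ge0.
apply: norm_le_coord => // i; rewrite submxE.
pose f := (fun s => y1 s i 0) - (fun s => y2 s i 0).
have sT s : 0 < s < t -> 0 < s < T.
  by move=> /andP[-> /lt_le_trans]; apply.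
apply: (@derive_norm_le _ t f (fun s => g (x1 s) i 0 - g (x2 s) i 0)
  (expo (2 * L) (K * 2^-1))
  (fun s => 2 * L * expo (2 * L) (K * 2^-1) s)) => //.
- by move=> s; apply: continuousB; apply: continuous_coord.
- exact: continuous_expo.
- by move=> s /sT sT'; apply: is_deriveB; [exact: dy1|exact: dy2].
- by move=> s _; exact: is_derive_expo.
- move=> s /sT sT'; rewrite -submxE (le_trans (coord_le_norm _ _))//.
  rewrite (le_trans (gL _ _))// expoM.
  by rewrite (_ : 2 * L * _ = L * expo (2 * L) K s) ?ler_pM2l ?x12//; field.
- by rewrite /f !fctE y0 subrr normr0.
Qed.

(** The difference of two solutions is bounded on [0 <= t <= T], and the
    contraction halves the bound indefinitely. *)
Lemma ode_unique (T : R) (x y : R -> 'cV[R]_k) :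
  continuous x -> continuous y -> x 0 = y 0 ->
  (forall t i, 0 < t < T -> is_derive t 1 (fun s => x s i 0) (g (x t) i 0)) ->
  (forall t i, 0 < t < T -> is_derive t 1 (fun s => y s i 0) (g (y t) i 0)) ->
  forall t, 0 <= t <= T -> x t = y t.
Proof.
move=> xc yc xy0 dx dy t tT.
have T0 : 0 <= T by case/andP: tT; exact: le_trans.
have dc : continuous (fun s => `|x s - y s|).
  by move=> s; apply: cvg_norm; apply: continuousB; [exact: xc|exact: yc].
have [c _ cmax] := EVT_max T0 (continuous_subspaceT dc).
set K := `|x c - y c| in cmax; have K0 : 0 <= K by exact: normr_ge0.
have L20 : 0 <= 2 * L by rewrite mulr_ge0// ltW.
have xyK j s : 0 <= s <= T ->
    `|x s - y s| <= expo (2 * L) (K * 2^-1 ^+ j) s.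
  elim: j s => [|j IH] s sT.
    rewrite expr0 mulr1; apply: (le_trans (cmax s _)); first by rewrite in_itv.
    by case/andP: sT => s0 _; exact: expo_ge.
  rewrite exprSr mulrA; apply: (picard_contraction (T := T) (x1 := x) (x2 := y)) => //.
    by rewrite mulr_ge0// exprn_ge0// invr_ge0.
  by move=> r /andP[r0 rT]; apply: IH; rewrite !ltW.
apply/eqP; rewrite -subr_eq0 -normr_le0; apply: (@half_pow_le0 (expo (2 * L) K t)).
by move=> j; rewrite -expoM; exact: xyK.
Qed.

(** Successive Picard iterates are at distance [C / 2 ^ j * expR (2 * L * t)],
    so they converge locally uniformly to a continuous [x]. The primitive [y] of
    [g \o x] is at distance [O(2 ^ - j)] from the iterates as well, so that
    [y = x] is a solution. *)
Lemma ode_exists (x0 : 'cV[R]_k) : exists x : R -> 'cV[R]_k,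
  [/\ continuous x, x 0 = x0 & forall (t : R) i, 0 < t ->
      is_derive t 1 (fun s => x s i 0) (g (x t) i 0)].
Proof.
have nextP (x : {x : R -> 'cV[R]_k | continuous x}) :
  exists y : {y : R -> 'cV[R]_k | continuous y}, [/\ sval y 0 = x0,
    forall t, sval y (Num.max 0 t) = sval y t &
    forall (t : R) i, 0 < t ->
      is_derive t 1 (fun s => sval y s i 0) (g (sval x t) i 0)].
  have [y [yc y0 ymax dy]] := primitive_exists x0
    (lipschitz_comp_continuous L0 gL (svalP x)).
  by exists (exist _ y yc).
have [next nextE] := choice nextP.
pose z0 : {x : R -> 'cV[R]_k | continuous x} := exist _ (cst x0) (@cst_continuous _ _ x0).
pose u j := sval (iter j next z0).
have uc j : continuous (u j) by exact: (svalP (iter j next z0)).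
have u0 j : u j 0 = x0.
  by case: j => [//|j]; have [] := nextE (iter j next z0).
have umax j t : u j (Num.max 0 t) = u j t.
  by case: j => [//|j]; have [_ H _] := nextE (iter j next z0); exact: H.
have du j (t : R) i : 0 < t ->
    is_derive t 1 (fun s => u j.+1 s i 0) (g (u j t) i 0).
  by have [_ _ H] := nextE (iter j next z0); exact: H.
(* [C] makes the derivative of [E C] dominate [`|g x0|]. *)
pose C := `|g x0| / (2 * L); pose E := expo (2 * L).
have L20 : 0 < 2 * L by rewrite mulr_gt0.
have C0 : 0 <= C by rewrite divr_ge0// ltW.
have CK0 j : 0 <= C * 2^-1 ^+ j by rewrite mulr_ge0// exprn_ge0// invr_ge0.
have uS j t : 0 <= t -> `|u j.+1 t - u j t| <= E (C * 2^-1 ^+ j) t.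
  elim: j t => [|j IH] t t0.
    rewrite expr0 mulr1; apply: norm_le_coord => [|i].
      by rewrite (le_trans C0)// expo_ge// ltW.
    rewrite submxE.
    apply: (@derive_norm_le _ t ((fun s => u 1%N s i 0) - cst (x0 i 0))
      (fun=> g x0 i 0 - 0) (E C) (fun s => 2 * L * E C s)) => //.
    + move=> s; apply: continuousB; first exact: continuous_coord.
      exact: cst_continuous.
    + exact: continuous_expo.
    + by move=> s /andP[s0 _]; apply: is_deriveB; exact: (du 0%N).
    + by move=> s _; exact: is_derive_expo.
    + move=> s /andP[s0 _]; rewrite subr0 (le_trans (coord_le_norm _ _))//.
      rewrite mulrC -ler_pdivrMr// -/C expo_ge// ltW//.
    + by rewrite !fctE u0 subrr normr0 (le_trans C0)// expo_ge// ltW.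
  rewrite /E exprSr mulrA.
  apply: (picard_contraction (T := t) (x1 := u j.+1) (x2 := u j)) => //.
  - by rewrite !u0.
  - by move=> s i /andP[s0 _]; exact: du.
  - by move=> s i /andP[s0 _]; exact: du.
  - by move=> s /andP[s0 _]; apply: IH; exact: ltW.
  - by rewrite t0 lexx.
pose E2 t := E (2 * C) (Num.max 0 t).
have E2_ge0 t : 0 <= E2 t.
  by apply: mulr_ge0; [rewrite mulr_ge0|exact: expR_ge0].
have limP t : exists xt : 'cV[R]_k, forall j, `|u j t - xt| <= E2 t * 2^-1 ^+ j.
  have /choice[l lE] i : exists li : R, forall j,
      `|u j t i 0 - li| <= 2 * E C (Num.max 0 t) * 2^-1 ^+ j.
    apply: geometric_cauchy => j; rewrite -submxE.
    apply: (le_trans (coord_le_norm _ _)); rewrite -!(umax _ t) -expoM.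
    exact/uS/max0_ge0.
  have -> : E2 t = 2 * E C (Num.max 0 t) by rewrite /E2 /E /expo mulrA.
  exists (\col_i l i) => j; apply: norm_le_coord => [|i]; last first.
    by rewrite submxE [X in _ - X]mxE.
  have EC0 : 0 <= E C (Num.max 0 t) by rewrite mulr_ge0 ?expR_ge0.
  by rewrite mulr_ge0 ?exprn_ge0 ?invr_ge0// mulr_ge0.
have [x xE] := choice limP.
have xc : continuous x.
  move=> t; apply/cvgrPdist_le => /= e e0.
  have e30 : 0 < e / 3 by rewrite divr_gt0.
  have [j jE] := half_pow_small (E2 (t + 1)) e30.
  have E2t s : s <= t + 1 -> E2 s * 2^-1 ^+ j <= e / 3.
    move=> st; apply: le_trans (ltW jE).
    apply: ler_wpM2r; first by rewrite exprn_ge0// invr_ge0.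
    apply: ler_wpM2l; first by rewrite mulr_ge0.
    rewrite ler_expR ler_pM2l//.
    by rewrite ge_max le_max lexx /= le_max st orbT.
  near=> s.
  have -> : x t - x s = - (u j t - x t) + (u j t - u j s) + (u j s - x s).
    by rewrite opprB !addrA !subrK.
  rewrite (_ : e = e / 3 + e / 3 + e / 3); last by field.
  rewrite (le_trans (ler_normD _ _))// lerD//.
    rewrite (le_trans (ler_normD _ _))// lerD// ?normrN.
      by rewrite (le_trans (xE t j))// E2t// lerDl.
    near: s; exact: ((cvgrPdist_le _ _).1 (uc j t)).
  rewrite (le_trans (xE s j))// E2t// ltW//; near: s.
  by apply: lt_nbhsl; rewrite ltrDl.
have [y [yc y0 _ dy]] := primitive_exists x0 (lipschitz_comp_continuous L0 gL xc).
have xy t : 0 <= t -> x t = y t.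
  move=> t0; apply/eqP; rewrite -subr_eq0 -normr_le0.
  apply: (@half_pow_le0 (2 * E2 t)) => j.
  have -> : x t - y t = - (u j.+1 t - x t) + (u j.+1 t - y t).
    by rewrite opprB !addrA subrK.
  rewrite (le_trans (ler_normD _ _))// normrN.
  have -> : 2 * E2 t * 2^-1 ^+ j = E2 t * 2^-1 ^+ j.+1
      + E (2 * C * 2^-1 ^+ j * 2^-1) t + E2 t * 2^-1 ^+ j.
    by rewrite /E2 max0_id// /E /expo exprS; field.
  apply: ler_wpDr; first by rewrite mulr_ge0 ?exprn_ge0 ?invr_ge0.
  rewrite lerD ?xE//.
  apply: (picard_contraction (T := t) (x1 := u j) (x2 := x)) => //.
  - by rewrite mulr_ge0 ?exprn_ge0 ?invr_ge0// mulr_ge0.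
  - by rewrite u0 y0.
  - by move=> s i /andP[s0 _]; exact: du.
  - by move=> s i /andP[s0 _]; exact: dy.
  - move=> s /andP[/ltW s0 _]; apply: (le_trans (xE s j)).
    by rewrite /E2 max0_id// /E -expoM.
  - by rewrite t0 lexx.
exists y; split=> // t i t0; rewrite -xy ?ltW//; exact: dy.
Unshelve. all: by end_near. Qed.

End Lipschitz.

End ODE.

(** * Exit times and norm estimates *)

Section Estimates.
Context {R : realType}.
Local Open Scope classical_set_scope.

(** If [u] never reaches [r] for the first time, it stays below [r]: otherwise
    the infimum of the times at which [r <= u] would be such a first time. *)
Lemma first_exit (u : R -> R) (r : R) : continuous u -> u 0 < r ->
  (forall T : R, 0 < T -> (forall t, 0 <= t <= T -> u t <= r) -> u T < r) ->
  forall t : R, 0 <= t -> u t < r.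
Proof.
move=> uc u0 uT t t0; rewrite ltNge; apply/negP => rut.
pose S : set R := [set s | 0 <= s /\ r <= u s].
have lbS : lbound S 0 by move=> s [].
have infS : has_inf S by split; [exists t|exists 0].
set T := inf S.
have T0 : 0 <= T by apply: lb_le_inf => //; exists t.
have before s : 0 <= s -> s < T -> u s < r.
  move=> s0 sT; rewrite ltNge; apply/negP => rs.
  by move: sT; rewrite ltNge => /negP; apply; apply: ge_inf; [exists 0|split].
have rT : r <= u T.
  rewrite leNgt; apply/negP => uTr.
  have e0 : 0 < r - u T by rewrite subr_gt0.
  have [d /= d0 dT] := (cvgrPdist_lt _ _).1 (uc T) _ e0.
  have [s [s0 rs] sTd] := inf_adherent d0 infS.
  have Ts : T <= s by apply: ge_inf; [exists 0|split].
  have := dT s; rewrite /ball_ /= => /(_ _); rewrite distrC => H.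
  have : `|u T - u s| < r - u T.
    by apply: H; rewrite ger0_norm ?subr_ge0// ltrBlDl.
  by rewrite ltr_norml => /andP[+ _]; lra.
have T_gt0 : 0 < T.
  rewrite lt_neqAle T0 andbT; apply: contraTneq u0 => ->.
  by rewrite -leNgt.
suff : u T < r by rewrite ltNge rT.
apply: uT => // s /andP[s0]; rewrite le_eqVlt => /predU1P[->|sT]; last first.
  exact/ltW/before.
rewrite leNgt; apply/negP => ruT.
have e0 : 0 < u T - r by rewrite subr_gt0.
have [d /= d0 dT] := (cvgrPdist_lt _ _).1 (uc T) _ e0.
pose w := Num.max (T / 2) (T - d / 2).
have wT : w < T by rewrite gt_max; apply/andP; split; lra.
have w0 : 0 <= w by rewrite le_max divr_ge0.
have dw : T - d / 2 <= w by rewrite le_max lexx orbT.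
have := dT w; rewrite /ball_ /= => H.
have : `|u T - u w| < u T - r.
  by apply: H; rewrite ger0_norm; lra.
by rewrite ltr_norml => /andP[_ H']; have := before _ w0 wT; lra.
Qed.

Lemma pos_lower_bound k (f : 'I_k -> R) : (forall i, 0 < f i) ->
  exists2 a : R, 0 < a & forall i, a <= f i.
Proof.
move=> f0; pose s := 1 + \sum_i (f i)^-1.
have sum0 (Q : pred 'I_k) : 0 <= \sum_(i | Q i) (f i)^-1.
  by apply: sumr_ge0 => i _; rewrite invr_ge0 ltW.
have s0 : 0 < s by rewrite ltr_pwDl.
exists s^-1; first by rewrite invr_gt0.
move=> i; rewrite -[leRHS]invrK lef_pV2 ?posrE ?invr_gt0//.
by rewrite /s (bigD1 i)//= addrCA lerDl addr_ge0.
Qed.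

(** A bound on the operator norm for the max norm; the summand [1] makes it
    positive for the zero matrix too. *)
Definition mx_bound m n (M : 'M[R]_(m, n)) : R := 1 + \sum_i \sum_j `|M i j|.

Lemma mx_bound_gt0 m n (M : 'M[R]_(m, n)) : 0 < mx_bound M.
Proof. by rewrite ltr_pwDl//; do 2![apply: sumr_ge0 => ? _]. Qed.

Lemma mx_bound_row m n (M : 'M[R]_(m, n)) i :
  \sum_j `|M i j| <= mx_bound M.
Proof.
rewrite /mx_bound (bigD1 i)//= addrCA lerDl addr_ge0//.
by do 2![apply: sumr_ge0 => ? _].
Qed.

Lemma mulcv_coord_le m n (M : 'M[R]_(m, n)) (x : 'cV[R]_n) i :
  `|(M *m x) i 0| <= mx_bound M * `|x|.
Proof.
rewrite mulcvE (le_trans (ler_norm_sum _ _ _))//.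
apply: (@le_trans _ _ ((\sum_j `|M i j|) * `|x|)).
  rewrite mulr_suml; apply: ler_sum => j _.
  by rewrite normrM ler_wpM2l// coord_le_norm.
by rewrite ler_wpM2r// mx_bound_row.
Qed.

Lemma norm_mulcv_le m n (M : 'M[R]_(m, n)) (x : 'cV[R]_n) :
  `|M *m x| <= mx_bound M * `|x|.
Proof.
apply: norm_le_coord => [|i]; last exact: mulcv_coord_le.
by rewrite mulr_ge0// ltW// mx_bound_gt0.
Qed.

Lemma lipschitz_mulcv m n (M : 'M[R]_(m, n)) :
  lipschitz_map (mx_bound M) (mulmx M : 'cV[R]_n -> 'cV[R]_m).
Proof. by move=> x y; rewrite -mulmxBr norm_mulcv_le. Qed.

Lemma sqr_norm_le k (x : 'cV[R]_k) (M : R) : 0 <= M ->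
  (forall i, x i 0 ^+ 2 <= M) -> `|x| ^+ 2 <= M.
Proof.
move=> M0 xM; rewrite -[leRHS]sqr_sqrtr// lerXn2r ?nnegrE ?sqrtr_ge0//.
apply: norm_le_coord => [|i]; first exact: sqrtr_ge0.
by rewrite -[leLHS]sqrtr_sqr ler_wsqrtr.
Qed.

Lemma qform_le k (P : 'M[R]_k) : exists2 c, 0 < c &
  forall x, qform P x <= c * `|x| ^+ 2.
Proof.
exists (1 + \sum_(i < k) mx_bound P) => [|x].
  by rewrite ltr_pwDl// sumr_ge0// => i _; rewrite ltW// mx_bound_gt0.
rewrite mulrDl mul1r ler_wpDl ?sqr_ge0// qformE mulr_suml.
apply: ler_sum => i _; rewrite (le_trans (ler_norm _))// normrM expr2 mulrA mulrC.
by rewrite ler_pM// ?coord_le_norm// mulcv_coord_le.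
Qed.

Lemma posdef_norm_le k (P : 'M[R]_k) : posdef P -> exists2 c, 0 < c &
  forall x, `|x| ^+ 2 <= c * qform P x.
Proof.
move=> Ppd; exists (mx_bound (invmx P)) => [|x]; first exact: mx_bound_gt0.
apply: sqr_norm_le => [|i].
  by rewrite mulr_ge0 ?posdef_ge0// ltW// mx_bound_gt0.
rewrite (le_trans (posdef_coord x i Ppd))// ler_wpM2r ?posdef_ge0//.
rewrite (le_trans _ (mx_bound_row _ i))//.
by rewrite (le_trans (ler_norm _))// (bigD1 i)//= lerDl sumr_ge0.
Qed.

(** [qform P x] is the form of [invmx P] at the vector [P x]. *)
Lemma posdef_gradient k (P : 'M[R]_k) : posdef P -> exists2 c, 0 < c &
  forall x, qform P x <= c * \sum_i (P *m x) i 0 ^+ 2.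
Proof.
move=> Ppd; have Pu := posdef_unitmx Ppd.
have [c c0 cP] := qform_le (invmx P); exists c => // x.
have -> : qform P x = qform (invmx P) (P *m x).
  by rewrite /qform trmx_mul Ppd.1 -!mulmxA mulKmx.
rewrite (le_trans (cP _))// ler_pM2l//; apply: sqr_norm_le => [|i].
  by apply: sumr_ge0 => i _; exact: sqr_ge0.
by rewrite (bigD1 i)//= lerDl sumr_ge0// => j _; exact: sqr_ge0.
Qed.

Lemma continuous_sum k (f : 'I_k -> R -> R) : (forall i, continuous (f i)) ->
  continuous (fun t => \sum_i f i t).
Proof.
move=> fc; have -> : (fun t => \sum_i f i t) = \sum_i f i.
  by apply/funext => t; rewrite fct_sumE.
elim/big_ind : _ => // [|g h gc hc]; first exact: cst_continuous.
by move=> t; apply: continuousD; [exact: gc|exact: hc].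
Qed.

Lemma is_derive_sum_fun k (f : 'I_k -> R -> R) (df : 'I_k -> R) (t : R) :
  (forall i, is_derive t 1 (f i) (df i)) ->
  is_derive t 1 (fun s => \sum_i f i s) (\sum_i df i).
Proof.
move=> fd; have -> : (fun s => \sum_i f i s) = \sum_i f i.
  by apply/funext => s; rewrite fct_sumE.
exact: is_derive_sum.
Qed.

Lemma continuous_mulcv m n (M : 'M[R]_(m, n)) (x : R -> 'cV[R]_n) :
  continuous x -> continuous (fun t => M *m x t).
Proof.
exact: (lipschitz_comp_continuous (mx_bound_gt0 M) (lipschitz_mulcv M)).
Qed.

Lemma continuous_qform k (P : 'M[R]_k) (x : R -> 'cV[R]_k) :
  continuous x -> continuous (fun t => qform P (x t)).
Proof.
move=> xc; under eq_fun do rewrite qformE; apply: continuous_sum => i t.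
apply: continuousM; apply: continuous_coord => //; exact: continuous_mulcv.
Qed.

Lemma is_derive_qform k (P : 'M[R]_k) (x : R -> 'cV[R]_k) (dx : 'cV[R]_k)
    (t : R) : P^T = P ->
  (forall i, is_derive t 1 (fun s => x s i 0) (dx i 0)) ->
  is_derive t 1 (fun s => qform P (x s)) (2 * \sum_i (P *m x t) i 0 * dx i 0).
Proof.
move=> Ps xd.
have -> : 2 * \sum_i (P *m x t) i 0 * dx i 0
  = \sum_i (x t i 0 *: (P *m dx) i 0 + (P *m x t) i 0 *: dx i 0).
  rewrite big_split /= mulr2n mulrDl mul1r; congr (_ + _).
  transitivity ((dx^T *m P *m x t) 0 0).
    by rewrite bilinE; apply: eq_bigr => i _; rewrite mulrC.
  by rewrite mulmx_symC// bilinE.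
under eq_fun do rewrite qformE; apply: is_derive_sum_fun => i.
apply: is_deriveM; rewrite mulcvE; under eq_fun do rewrite mulcvE.
by apply: is_derive_sum_fun => j; exact: is_deriveZ.
Qed.

End Estimates.

(** * The truncated inverter dynamics and its Lyapunov function *)

Section Truncation.
Context {R : realType}.

Definition clip (c s : R) : R := if s < - c then - c else if c < s then c else s.

Lemma clip_norm_le c s : 0 <= c -> `|clip c s| <= c.
Proof.
move=> c0; rewrite /clip ler_norml; case: ltP => ?; first by apply/andP; split; lra.
by case: ltP => ?; apply/andP; split; lra.
Qed.

Lemma clip_id c s : `|s| <= c -> clip c s = s.
Proof.
rewrite ler_norml => /andP[cs sc]; rewrite /clip.
by case: ltP => ?; [lra|case: ltP => ?; lra].
Qed.

Lemma clip_lipschitz c s t : 0 <= c -> `|clip c s - clip c t| <= `|s - t|.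
Proof.
move=> c0; wlog ts : s t / t <= s => [H|].
  by have [/H//|/ltW/H] := leP t s; rewrite distrC [leRHS]distrC.
rewrite (ger0_norm (x := s - t)) ?subr_ge0// ler_norml /clip.
by do 4?[case: ltP => ?]; apply/andP; split; lra.
Qed.

Lemma mulr_clip_ge0 c s : 0 <= c -> 0 <= s * clip c s.
Proof.
move=> c0; rewrite /clip; case: ltP => ?; first by rewrite mulr_le0//; lra.
by case: ltP => ?; [rewrite mulr_ge0//; lra|rewrite -expr2 sqr_ge0].
Qed.

End Truncation.

Section ReducedSystem.
Context {R : realType} {k : nat}.
Local Open Scope classical_set_scope.
Variables (P : 'M[R]_k) (a tau : 'cV[R]_k).
Hypotheses (Ppd : posdef P) (a_gt0 : positive a) (tau_gt0 : positive tau).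

(** With [x] the deviation of the inverter voltages from [a], this is the field
    [- (a_i + x_i) / tau_i * (P x)_i], whose first factor is kept between
    [a_i / 2 / tau_i] and [3 * a_i / 2 / tau_i] and whose second factor is kept
    in [-1, 1]: this makes it globally Lipschitz and preserves the sign of
    each factor. *)
Definition trunc_field (x : 'cV[R]_k) : 'cV[R]_k :=
  \col_i - ((a i 0 + clip (a i 0 / 2) (x i 0)) / tau i 0 * clip 1 ((P *m x) i 0)).

Definition untruncated (x : 'cV[R]_k) : Prop := forall i,
  `|x i 0| <= a i 0 / 2 /\ `|(P *m x) i 0| <= 1.

Definition trunc_solution (T : R) (x : R -> 'cV[R]_k) : Prop :=
  continuous x /\ forall t i, 0 < t < T ->
    is_derive t 1 (fun s => x s i 0) (trunc_field (x t) i 0).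

Lemma trunc_fieldE x i : untruncated x ->
  trunc_field x i 0 = - ((a i 0 + x i 0) / tau i 0 * (P *m x) i 0).
Proof. by move=> /(_ i)[xi Px]; rewrite mxE !clip_id. Qed.

Lemma trunc_coeff_bounds (x : 'cV[R]_k) i :
  a i 0 / 2 / tau i 0 <= (a i 0 + clip (a i 0 / 2) (x i 0)) / tau i 0
    <= 2 * a i 0 / tau i 0.
Proof.
have ai := a_gt0 i; have a2 : 0 <= a i 0 / 2 by lra.
have := clip_norm_le (x i 0) a2; rewrite ler_norml => /andP[l u].
by rewrite !ler_pM2r ?invr_gt0//; apply/andP; split; lra.
Qed.

Lemma trunc_field_lipschitz : exists2 L : R, 0 < L & lipschitz_map L trunc_field.
Proof.
pose Li i := 2 * a i 0 / tau i 0 * mx_bound P + (tau i 0)^-1.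
have Li0 i : 0 <= Li i.
  have a0 : 0 <= a i 0 by exact: ltW.
  have t0 : 0 <= tau i 0 by exact: ltW.
  have b0 : 0 <= mx_bound P by rewrite ltW// mx_bound_gt0.
  by rewrite addr_ge0 ?invr_ge0// mulr_ge0// mulr_ge0 ?invr_ge0// mulr_ge0.
have L0 : 0 < 1 + \sum_i Li i by rewrite ltr_pwDl// sumr_ge0.
exists (1 + \sum_i Li i) => // x y; apply: norm_le_coord => [|i].
  by rewrite mulr_ge0// ltW.
apply: (@le_trans _ _ (Li i * `|x - y|)); last first.
  by rewrite ler_wpM2r// (bigD1 i)//= addrCA lerDl addr_ge0// sumr_ge0.
have t0 := tau_gt0 i; have a0 := a_gt0 i.
have a2 : 0 <= a i 0 / 2 by lra.
rewrite submxE [trunc_field x i 0]mxE [trunc_field y i 0]mxE.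
set cx := clip _ (x i 0); set cy := clip _ (y i 0).
set dx := clip 1 _; set dy := clip 1 _.
have -> : - ((a i 0 + cx) / tau i 0 * dx) - - ((a i 0 + cy) / tau i 0 * dy)
  = - ((a i 0 + cx) / tau i 0 * (dx - dy)) - (cx - cy) / tau i 0 * dy.
  by field; rewrite gt_eqF.
rewrite (_ : Li i * _ = 2 * a i 0 / tau i 0 * mx_bound P * `|x - y|
  + (tau i 0)^-1 * `|x - y|); last by rewrite mulrDl.
rewrite (le_trans (ler_normB _ _))// normrN lerD//.
  rewrite normrM -mulrA ler_pM//.
    have /andP[l u] := trunc_coeff_bounds x i.
    by rewrite ger0_norm// (le_trans _ l)// !mulr_ge0 ?invr_ge0// ltW.
  rewrite (le_trans (clip_lipschitz _ _ _))//.
  by rewrite -submxE -mulmxBr mulcv_coord_le.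
rewrite normrM [leRHS]mulrC -[leRHS]mulr1 ler_pM//; last exact: clip_norm_le.
rewrite normrM ler_pM//; last by rewrite gtr0_norm// invr_gt0.
by rewrite (le_trans (clip_lipschitz _ _ _))// -submxE coord_le_norm.
Qed.

Lemma trunc_qform_derive T x : trunc_solution T x -> forall t : R, 0 < t < T ->
  is_derive t 1 (fun s => qform P (x s))
    (2 * \sum_i (P *m x t) i 0 * trunc_field (x t) i 0).
Proof.
by move=> [_ dx] t tT; apply: is_derive_qform (Ppd.1) _ => i; exact: dx.
Qed.

(** The clipped factor has the sign of [(P x)_i] and its coefficient is
    positive, so [qform P] is a Lyapunov function also outside the untruncated
    region. *)
Lemma trunc_qform_nincr T x t : trunc_solution T x -> 0 <= t <= T ->
  qform P (x t) <= qform P (x 0).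
Proof.
move=> sol /andP[t0 tT]; have [xc _] := sol.
apply: (@derive_le0_le _ t (fun s => qform P (x s)) _ t0 (continuous_qform xc)).
  move=> s /andP[s0 st]; apply: (trunc_qform_derive sol).
  by rewrite s0 (lt_le_trans st).
move=> s _; rewrite mulr_ge0_le0//; apply: sumr_le0 => i _.
rewrite [trunc_field _ _ _]mxE mulrN oppr_le0 mulrCA mulr_ge0 ?mulr_clip_ge0//.
have /andP[l _] := trunc_coeff_bounds (x s) i; apply: le_trans l.
by have := a_gt0 i; have := tau_gt0 i => ? ?; rewrite !mulr_ge0 ?invr_ge0// ltW.
Qed.

(** Where the clipping is inactive, the derivative of [V = qform P x] is at most
    [- 2 * b * sum_i (P x)_i ^ 2 <= - l * V], so [V * expR (l * t)] is
    nonincreasing. *)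
Lemma trunc_qform_decay : exists2 l : R, 0 < l &
  forall T x t, trunc_solution T x -> (forall s, 0 < s < T -> untruncated (x s)) ->
    0 <= t <= T -> qform P (x t) <= qform P (x 0) * expR (- (l * t)).
Proof.
have [c c0 cP] := posdef_gradient Ppd.
have coeff0 i : 0 < a i 0 / 2 / tau i 0 by rewrite !divr_gt0.
have [b b0 ba] := pos_lower_bound coeff0.
pose l := 2 * b / c; have l0 : 0 < l by rewrite divr_gt0// mulr_gt0.
exists l => // T x t sol xun /andP[t0 tT]; have [xc _] := sol.
rewrite expRN ler_pdivlMr ?expR_gt0//.
pose W := (fun s => qform P (x s)) * expo l 1.
suff : W t <= W 0 by rewrite /W !fctE /expo !mul1r mulr0 expR0 mulr1.
pose dV s := 2 * \sum_i (P *m x s) i 0 * trunc_field (x s) i 0.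
apply: (@derive_le0_le _ t W (fun s => qform P (x s) *: (l * expo l 1 s)
    + expo l 1 s *: dV s)) => //.
- by move=> s; apply: continuousM; [exact: continuous_qform|exact: continuous_expo].
- move=> s /andP[s0 st]; apply: is_deriveM; last exact: is_derive_expo.
  by apply: (trunc_qform_derive sol); rewrite s0 (lt_le_trans st).
move=> s /andP[s0 st].
have un : untruncated (x s) by apply: xun; rewrite s0 (lt_le_trans st).
have e0 : 0 < expo l 1 s by rewrite /expo mul1r expR_gt0.
rewrite /GRing.scale /= mulrA [_ * l]mulrC [X in _ + X]mulrC -mulrDl.
rewrite mulr_le0_ge0 ?(ltW e0)//.
suff : dV s <= - (l * qform P (x s)) by lra.
apply: (@le_trans _ _ (- (2 * b * \sum_i (P *m x s) i 0 ^+ 2))); last first.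
  rewrite lerN2 (_ : l * _ = 2 * b * (qform P (x s) / c)); last by rewrite /l; ring.
  by rewrite ler_pM2l ?mulr_gt0// ler_pdivrMr// mulrC.
rewrite /dV -mulrA -mulrN ler_pM2l// mulr_sumr -sumrN; apply: ler_sum => i _.
rewrite trunc_fieldE// mulrN lerN2 [leRHS]mulrCA -[_ * (P *m x s) i 0]expr2.
apply: ler_wpM2r; first exact: sqr_ge0.
rewrite (le_trans (ba i))//; have /andP[+ _] := trunc_coeff_bounds (x s) i.
by rewrite clip_id//; case: (un i).
Qed.

End ReducedSystem.

(** * Linearity of the algebraic equations *)

Section SlowManifold.
Context {R : realType} {n m : nat}.
Local Open Scope classical_set_scope.
Variables (S : 'M[R]_(n + m)) (e : 'cV[R]_(n + m)).
Hypotheses (Spd : posdef S) (e_gt0 : positive e).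

Let A := ulsubmx S.
Let C := ursubmx S.
Let D := drsubmx S.

Definition reduced_mx : 'M[R]_m := schur D C^T A.

(** Maps [x] to the vector [z] with lower part [x] for which the upper part of
    [S *m z] vanishes. *)
Definition lift_mx : 'M[R]_(n + m, m) := col_mx (- (invmx A *m C)) 1%:M.

Definition state_field (E : 'cV[R]_(n + m)) : 'cV[R]_(n + m) :=
  - (diagv E *m S *m (E - e)).

Let P := reduced_mx.
Let H := lift_mx.

Lemma state_block : S = block_mx A C C^T D.
Proof. by rewrite /C trmx_ursub Spd.1 submxK. Qed.

Lemma reduced_posdef : posdef A /\ posdef P.
Proof.
apply/posdef_schurP; rewrite trmxK; apply: posdef_blockC.
by rewrite -state_block.
Qed.

Lemma mul_lift (x : 'cV[R]_m) : S *m (H *m x) = col_mx 0 (P *m x).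
Proof.
have Au := posdef_unitmx reduced_posdef.1.
rewrite [in LHS]state_block /H /lift_mx (mul_col_mx _ 1%:M).
rewrite mul_block_col mul1mx.
rewrite !mulNmx !mulmxN -(mulmxA _ C x) mulKVmx// addNr.
by rewrite /P /reduced_mx /schur trmxK mulmxBl addrC !mulmxA.
Qed.

Lemma state_fieldE E i : state_field E i 0 = - (E i 0 * (S *m (E - e)) i 0).
Proof. by rewrite /state_field -mulmxA oppmxE mul_diagvE. Qed.

(** The positive factors [E_i] of the algebraic equations can be cancelled. *)
Lemma algebraic_lift E : positive E -> usubmx (state_field E) = 0 ->
  E - e = H *m dsubmx (E - e).
Proof.
move=> E0 /matrixP alg; have Au := posdef_unitmx reduced_posdef.1.
set z := E - e; rewrite -[LHS]vsubmxK /H /lift_mx mul_col_mx mul1mx; congr col_mx.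
have : A *m usubmx z + C *m dsubmx z = 0.
  have -> : A *m usubmx z + C *m dsubmx z = usubmx (S *m z).
    by rewrite state_block -{3}[z]vsubmxK mul_block_col col_mxKu.
  apply/matrixP => i j; rewrite ord1 [LHS]mxE [RHS]mxE; apply/eqP.
  have /eqP : state_field E (lshift m i) 0 = 0.
    transitivity (usubmx (state_field E) i 0); first by rewrite [RHS]mxE.
    by rewrite alg mxE.
  by rewrite state_fieldE oppr_eq0 mulf_eq0 gt_eqF.
move=> /(congr1 (mulmx (invmx A))); rewrite mulmxDr mulKmx// mulmx0 => /eqP.
by rewrite addr_eq0 mulNmx -mulmxA => /eqP.
Qed.

Lemma usubmx_field_lift (x : 'cV[R]_m) : usubmx (state_field (e + H *m x)) = 0.
Proof.
apply/matrixP => i j; rewrite ord1 [LHS]mxE [RHS]mxE state_fieldE.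
rewrite [e + _]addrC addrK mul_lift col_mxEu.
by rewrite [X in _ * X](_ : _ = 0) ?mulr0 ?oppr0// mxE.
Qed.

Lemma dsubmx_lift (x : 'cV[R]_m) : dsubmx (H *m x) = x.
Proof. by rewrite mul_col_mx mul1mx col_mxKd. Qed.

Lemma dsubmx_field_lift (x : 'cV[R]_m) i : dsubmx (state_field (e + H *m x)) i 0
  = - ((dsubmx e i 0 + x i 0) * (P *m x) i 0).
Proof.
rewrite [LHS]mxE state_fieldE [e + _]addrC addrK mul_lift col_mxEd addmxE.
have -> : x i 0 = (H *m x) (rshift n i) 0 by rewrite -{1}(dsubmx_lift x) mxE.
by rewrite [dsubmx e i 0]mxE addrC.
Qed.

Lemma region_exists : exists2 r : R, 0 < r & forall E, `|E - e| <= r ->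
  positive E /\ untruncated P (dsubmx e) (dsubmx (E - e)).
Proof.
have e2 i : 0 < e i 0 / 2 by rewrite divr_gt0.
have [b b0 be] := pos_lower_bound e2.
exists (Num.min b (mx_bound P)^-1) => [|E].
  by rewrite lt_min b0 invr_gt0 mx_bound_gt0.
rewrite le_min => /andP[Eb EP].
have Ei i : `|(E - e) i 0| <= e i 0 / 2.
  by rewrite (le_trans (coord_le_norm _ _))// (le_trans Eb).
have dE : `|dsubmx (E - e)| <= `|E - e|.
  by apply: norm_le_coord => // i; rewrite mxE coord_le_norm.
split=> [i|i].
  by have := Ei i; rewrite submxE ler_norml => /andP[]; have := e_gt0 i; lra.
split; first by rewrite ![dsubmx _ i 0]mxE.
rewrite (le_trans (mulcv_coord_le _ _ _))// -ler_pdivlMl ?mx_bound_gt0//.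
by rewrite mulr1 (le_trans dE).
Qed.

End SlowManifold.

(** * Exponential stability *)

Section Stability.
Context {R : realType}.
Local Open Scope classical_set_scope.

Lemma is_derive_cvP k (x : R -> 'cV[R]_k) (dx : 'cV[R]_k) (t : R) :
  (forall i, is_derive t 1 (fun s => x s i 0) (dx i 0)) <->
  derivable x t 1 /\ x^`() t = dx.
Proof.
split=> [xd|[xd <-] i].
  have dxt : derivable x t 1.
    by apply/derivable_mxP => i j; rewrite ord1; have [] := xd i.
  split=> //; rewrite derive1E derive_mx//; apply/matrixP => i j.
  by rewrite mxE ord1; have [] := xd i.
have /derivable_mxP/(_ i 0) xid := xd.
by apply: DeriveDef => //; rewrite derive1E derive_mx// mxE.
Qed.

Variables (n m : nat) (S : 'M[R]_(n + m)) (e : 'cV[R]_(n + m)) (tau : 'cV[R]_m).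
Hypotheses (Spd : posdef S) (e_gt0 : positive e) (tau_gt0 : positive tau).

Let P := reduced_mx S.
Let H := lift_mx S.
Let F := state_field S e.
Let Ppd : posdef P := (reduced_posdef Spd).2.

Notation field := (trunc_field P (dsubmx e) tau).

Lemma field_untruncated x i : untruncated P (dsubmx e) x ->
  tau i 0 * field x i 0 = dsubmx (F (e + H *m x)) i 0.
Proof.
move=> un; rewrite trunc_fieldE// dsubmx_field_lift//.
by field; rewrite gt_eqF.
Qed.

Lemma lift_dae_solution (x : R -> 'cV[R]_m) : continuous x ->
  (forall (t : R) i, 0 < t -> is_derive t 1 (fun s => x s i 0) (field (x t) i 0)) ->
  (forall t, 0 <= t -> untruncated P (dsubmx e) (x t)) ->
  dae_solution tau F (fun t => e + H *m x t).
Proof.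
move=> xc dx xun; split.
- apply: continuous_subspaceT => t; apply: cvgD; first exact: cvg_cst.
  exact: continuous_mulcv.
- by move=> t _; exact: usubmx_field_lift.
- move=> t t0.
  have -> : (fun s => dsubmx (e + H *m x s)) = (fun s => dsubmx e + x s).
    by apply/funext => s; rewrite linearD /= dsubmx_lift.
  have [|xd xE] := (is_derive_cvP (fun s => dsubmx e + x s) (field (x t)) t).1.
    move=> i.
    have -> : (fun s => (dsubmx e + x s) i 0) = cst (dsubmx e i 0) + (fun s => x s i 0).
      by apply/funext => s; rewrite addmxE.
    by rewrite -[field _ _ _]add0r; apply: is_deriveD; exact: dx.
  split=> //; rewrite xE; apply/matrixP => i j; rewrite ord1 mul_diagvE.
  by rewrite field_untruncated//; apply: xun; exact: ltW.
Qed.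

(** Conversely, as long as a solution stays where the algebraic equations are
    linear, its inverter components solve the truncated system. *)
Lemma dae_trunc_solution (T : R) (E : R -> 'cV[R]_(n + m)) :
  dae_solution tau F E ->
  (forall t, 0 <= t <= T -> positive (E t) /\
     untruncated P (dsubmx e) (dsubmx (E t - e))) ->
  trunc_solution P (dsubmx e) tau T (fun t : R => dsubmx (E (Num.max 0 t) - e)).
Proof.
move=> [Ec Ealg Ed] reg.
have Emaxc := within_continuous_max0 Ec.
have xE t i : dsubmx (E t - e) i 0 = dsubmx (E t) i 0 - dsubmx e i 0.
  by rewrite !mxE.
split=> [|t i /andP[t0 tT]].
  apply: continuous_cV => i.
  have -> : (fun t => dsubmx (E (Num.max 0 t) - e) i 0)
     = (fun t => E (Num.max 0 t) (rshift n i) 0) - cst (dsubmx e i 0).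
    by apply/funext => t; rewrite !fctE xE [dsubmx (E _) _ _]mxE.
  move=> t; apply: continuousB; last exact: cst_continuous.
  exact: continuous_coord.
have t_ge0 := ltW t0; have [dE odeE] := Ed t t0.
have tTr : 0 <= t <= T by rewrite t_ge0 ltW.
have [Epos un] := reg t tTr.
have lift := algebraic_lift Spd Epos (Ealg t t_ge0).
set x := dsubmx (E t - e) in un lift.
have EE : E t = e + H *m x by rewrite -lift addrC subrK.
rewrite max0_id// -/x.
apply: (near_eq_is_derive
  (f := (fun s => dsubmx (E s) i 0) - cst (dsubmx e i 0))).
  by near=> s; rewrite !fctE max0_id ?xE// ltW//; near: s; exact: lt_nbhsr.
rewrite -[field x i 0]subr0; apply: is_deriveB.
have -> : field x i 0 = ((fun s => dsubmx (E s))^`() t) i 0.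
  apply: (mulfI (lt0r_neq0 (tau_gt0 i))).
  by rewrite field_untruncated// -EE -odeE mul_diagvE.
exact: (is_derive_cvP (fun s => dsubmx (E s)) _ t).2.
Unshelve. all: by end_near. Qed.

(** The solution of the truncated system that starts at [x0] is lifted. The
    radius [d] is chosen so that [c * d < r], where the ball of radius [r]
    around [e] is one in which the clipping is inactive and the voltages are
    positive: the lifted solution and, by [first_exit], every other solution
    stay in this ball. *)
Theorem posdef_stable : locally_exponentially_stable tau F e.
Proof.
have ed_gt0 : positive (dsubmx e) by move=> i; rewrite mxE.
have [r r0 reg] := region_exists S e_gt0.
have [L L0 gL] := trunc_field_lipschitz P ed_gt0 tau_gt0.
have [l l0 decay] := trunc_qform_decay Ppd ed_gt0 tau_gt0.
have [c1 c10 c1P] := qform_le P.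
have [c2 c20 c2P] := posdef_norm_le Ppd.
pose q := Num.sqrt (c2 * c1); pose h := mx_bound H; pose c := h * q.
have q0 : 0 < q by rewrite sqrtr_gt0 mulr_gt0.
have h0 : 0 < h by exact: mx_bound_gt0.
have c0 : 0 < c by rewrite mulr_gt0.
pose d := r / (1 + c).
have d0 : 0 < d by rewrite divr_gt0// addr_gt0.
have dE : d + c * d = r by rewrite /d; field; rewrite gt_eqF// addr_gt0.
have cd0 : 0 < c * d by rewrite mulr_gt0.
have qnorm (v w : 'cV[R]_m) b : 0 <= b -> qform P v <= qform P w * b ^+ 2 ->
    `|v| <= q * `|w| * b.
  move=> b0 vw; rewrite -(ler_pXn2r (n := 2)) ?nnegrE ?mulr_ge0 ?(ltW q0)//.
  rewrite (le_trans (c2P v))// 2!exprMn sqr_sqrtr; last by rewrite mulr_ge0// ltW.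
  rewrite (_ : c2 * c1 * _ * _ = c2 * (c1 * `|w| ^+ 2 * b ^+ 2)); last by ring.
  by rewrite ler_pM2l// (le_trans vw)// ler_wpM2r ?sqr_ge0.
exists d, c, (l / 2); split=> //; first by rewrite divr_gt0.
move=> E0 alg0 E0d; pose x0 := dsubmx (E0 - e).
have x0E : `|x0| <= `|E0 - e|.
  by apply: norm_le_coord => // i; rewrite mxE coord_le_norm.
have E0r : `|E0 - e| < r by rewrite (lt_trans E0d)// -dE ltrDl.
have [E0pos _] := reg _ (ltW E0r).
have E0E : E0 = e + H *m x0.
  by rewrite -(algebraic_lift Spd E0pos alg0) addrC subrK.
have [x [xc x00 dx]] := ode_exists L0 gL x0.
have sol T : trunc_solution P (dsubmx e) tau T x.
  by split=> // t i /andP[t0 _]; exact: dx.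
have lift_norm v : `|e + H *m v - e| <= h * `|v|.
  by rewrite [e + _]addrC addrK norm_mulcv_le.
have lift_r t : 0 <= t -> `|e + H *m x t - e| < r.
  move=> t0; have xt : `|x t| <= q * `|x0| * 1.
    apply: qnorm => //; rewrite expr1n mulr1 -x00.
    by apply: (trunc_qform_nincr Ppd ed_gt0 tau_gt0 (sol t)); rewrite t0 lexx.
  rewrite mulr1 in xt; rewrite (le_lt_trans (lift_norm _))//.
  have cE : c * `|E0 - e| < c * d by rewrite ltr_pM2l.
  apply: (@le_lt_trans _ _ (c * `|E0 - e|)); last by lra.
  by rewrite -mulrA ler_pM2l// (le_trans xt)// ler_pM2l.
have un t : 0 <= t -> untruncated P (dsubmx e) (x t).
  move=> t0; have [_] := reg _ (ltW (lift_r t t0)).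
  by rewrite [e + _]addrC addrK dsubmx_lift.
exists (fun t => e + H *m x t); split.
- exact: lift_dae_solution.
- by rewrite x00.
- move=> E' sol' E'0.
  have agree T : 0 <= T -> (forall t, 0 <= t <= T -> `|E' t - e| <= r) ->
      E' T = e + H *m x T.
    move=> T0 near_e.
    have reg' t : 0 <= t <= T -> positive (E' t) /\
        untruncated P (dsubmx e) (dsubmx (E' t - e)).
      by move=> tT; apply: reg; exact: near_e.
    have [yc dy] := dae_trunc_solution sol' reg'.
    have TT : 0 <= T <= T by rewrite T0 lexx.
    have y0 : dsubmx (E' (Num.max 0 0) - e) = x 0 by rewrite maxxx E'0 x00.
    have := ode_unique L0 gL yc xc y0 dy (sol T).2 TT.
    rewrite max0_id// => <-; have [E'pos _] := reg' T TT.
    have [_ alg' _] := sol'.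
    by rewrite -(algebraic_lift Spd E'pos (alg' T T0)) addrC subrK.
  have E'c := let: And3 H' _ _ := sol' in within_continuous_max0 H'.
  have near_e : forall t : R, 0 <= t -> `|E' (Num.max 0 t) - e| < r.
    apply: first_exit.
    - move=> t; apply: cvg_norm; apply: cvgB; [exact: E'c|exact: cvg_cst].
    - by rewrite maxxx E'0.
    - move=> T T0 near_e; have T_ge0 := ltW T0.
      rewrite max0_id// agree ?lift_r// => t tT.
      by have := near_e t tT; rewrite max0_id//; case/andP: tT.
  move=> t t0; apply: agree => // s /andP[s0 _].
  by have := near_e s s0; rewrite max0_id// => /ltW.
- move=> t t0; have xt : `|x t| <= q * `|x0| * expR (- (l / 2 * t)).
    apply: qnorm; first exact: expR_ge0.
    have -> : expR (- (l / 2 * t)) ^+ 2 = expR (- (l * t)).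
      by rewrite -expRM_natl; congr expR; field.
    rewrite -x00; apply: (decay t x t (sol t)); last by rewrite t0 lexx.
    by move=> s /andP[s0 _]; apply: un; exact: ltW.
  rewrite (le_trans (lift_norm _))//.
  rewrite (_ : c * _ * _ = h * (q * `|E0 - e| * expR (- (l / 2 * t)))); last first.
    by rewrite /c; ring.
  by rewrite ler_pM2l// (le_trans xt)// ler_wpM2r ?expR_ge0// ler_pM2l.
Qed.

End Stability.

(** * The matrices of the network *)

Section NetworkMatrices.
Context {R : realType} {n m : nat}.
Variables (B : 'M[R]_(n + m)) (K : 'cV[R]_m).
Hypothesis B_sym : B^T = B.

Lemma invmx_opp k (A : 'M[R]_k) : invmx (- A) = - invmx A.
Proof.
have [Au|/negbTE Au] := boolP (A \in unitmx).
  have NAu : - A \in unitmx by rewrite -scaleN1r unitmxZ// unitrN1.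
  by move: NAu; rewrite -scaleN1r => NAu; rewrite invmxZ// invrN1 scaleN1r.
have NAu : (- A \in unitmx) = false by rewrite -scaleN1r unitmxZ ?unitrN1.
by rewrite /invmx Au NAu.
Qed.

Definition shunt_mx (b : 'cV[R]_n) : 'M[R]_(n + m) :=
  - (B + diagv (col_mx b K)).

Lemma shunt_mx_block (b : 'cV[R]_n) : shunt_mx b =
  block_mx (- (B_LL B + diagv b)) (- B_LI B) (- B_LI B)^T (- (B_II B + diagv K)).
Proof.
have IL : (- B_LI B)^T = - B_IL B by rewrite linearN /= trmx_ursub B_sym.
rewrite IL /shunt_mx /diagv tr_col_mx diag_mx_row -[B in LHS]submxK.
by rewrite add_block_mx !addr0 opp_block_mx.
Qed.

Lemma schur_shunt_mx (b : 'cV[R]_n) :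
  schur (- (B_LL B + diagv b)) (- B_LI B) (- (B_II B + diagv K))
  = - (B_red B K + diagv b).
Proof.
have IL : (- B_LI B)^T = - B_IL B by rewrite linearN /= trmx_ursub B_sym.
rewrite /schur IL invmx_opp !(mulNmx, mulmxN) !opprK /B_red.
by rewrite [in RHS]addrAC opprB [LHS]addrC.
Qed.

Lemma shunt_posdefP (b : 'cV[R]_n) : posdef (shunt_mx b) <->
  posdef (- (B_II B + diagv K)) /\ posdef (- (B_red B K + diagv b)).
Proof. by rewrite shunt_mx_block -schur_shunt_mx; exact: posdef_schurP. Qed.

Lemma shunt_mxE (b : 'cV[R]_n) (E : 'cV[R]_(n + m)) i : (shunt_mx b *m E) i 0
  = - ((B *m E) i 0 + col_mx b K i 0 * E i 0).
Proof. by rewrite mulNmx oppmxE mulmxDl addmxE mul_diagvE. Qed.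

Lemma closed_loop_state_field (b Ish : 'cV[R]_n) (Es : 'cV[R]_m) (e E : 'cV[R]_(n + m)) :
  shunt_mx b *m e = col_mx Ish (- (diagv K *m Es)) ->
  closed_loop B K Es (Q_ZI b Ish) E = state_field (shunt_mx b) e E.
Proof.
move=> eE; apply/matrixP => i j; rewrite ord1 state_fieldE mulmxBr eE submxE.
rewrite shunt_mxE /closed_loop addmxE -[diagv E *m B *m E]mulmxA mul_diagvE.
case: (split_ordP i) => k ->.
  rewrite !col_mxEu /Q_ZI addmxE -mulmxA !mul_diagvE [usubmx _ _ _]mxE; ring.
rewrite !col_mxEd -mulmxA oppmxE !mul_diagvE submxE [dsubmx _ _ _]mxE; ring.
Qed.

Lemma reduced_power_flow_pos (b Ish EL : 'cV[R]_n) (Es : 'cV[R]_m) : positive EL ->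
  reduced_power_flow B K Es (Q_ZI b Ish) EL <->
  (B_red B K + diagv b) *m EL = B_red B K *m E_Lstar B K Es - Ish.
Proof.
move=> EL0; pose X := (B_red B K + diagv b) *m EL - (B_red B K *m E_Lstar B K Es - Ish).
have XE : Q_ZI b Ish EL + diagv EL *m B_red B K *m (EL - E_Lstar B K Es)
    = diagv EL *m X.
  apply/matrixP => i j; rewrite ord1 /Q_ZI !addmxE -!(mulmxA (diagv EL)) !mul_diagvE.
  rewrite mulmxBr /X (mulmxDl (B_red B K)) 3!submxE addmxE mul_diagvE; ring.
rewrite /reduced_power_flow XE; split=> [/esym X0|X0]; last first.
  by rewrite /X X0 subrr mulmx0.
apply/eqP; rewrite -subr_eq0 -/X; apply/eqP/matrixP => i j.
have /eqP : EL i 0 * X i 0 = 0 by rewrite -mul_diagvE X0 mxE.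
by rewrite ord1 mulf_eq0 gt_eqF ?EL0//= => /eqP ->; rewrite mxE.
Qed.

End NetworkMatrices.

(** * The equilibrium of the closed loop *)

Theorem mainTheorem3 (R : realType) (n m : nat)
    (edge : rel 'I_(n + m)) (B : 'M[R]_(n + m))
    (K tau Es : 'cV[R]_m) (b Ish : 'cV[R]_n)
    (n_gt0 : (0 < n)%N) (m_gt0 : (0 < m)%N)
    (G_connected : connected_graph edge)
    (B_susceptance : susceptance_matrix edge B)
    (K_lt0 : forall i, K i 0 < 0)
    (tau_gt0 : positive tau)
    (Es_gt0 : positive Es)
    (hyp_i : M_matrix (- (B_red B K + diagv b)))
    (hyp_ii : forall i, (B_red B K *m E_Lstar B K Es) i 0 < Ish i 0) :
  let E_LZI := invmx (B_red B K + diagv b) *m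
                 (B_red B K *m E_Lstar B K Es - Ish) in
  let E_IZI := W2 B K *m col_mx E_LZI Es in
  let F := closed_loop B K Es (Q_ZI b Ish) in
  [/\ B_red B K + diagv b \in unitmx,
      unique (fun EL => positive EL /\
                reduced_power_flow B K Es (Q_ZI b Ish) EL) E_LZI,
      dae_equilibrium F (col_mx E_LZI E_IZI) &
      locally_exponentially_stable tau F (col_mx E_LZI E_IZI)].
Proof.
move=> EL EI F.
have [Bsym Bpos Bnoedge _] := B_susceptance.
have BT : B^T = B by apply/matrixP => i j; rewrite mxE Bsym.
have B_ge0 i j : i != j -> 0 <= B i j.
  by move=> ij; have [/Bpos/ltW//|/Bnoedge->//] := boolP (edge i j).
pose Br := B_red B K; pose Es' := E_Lstar B K Es.
(* With no shunts, both facts come from the Laplacian grounded at the inverters,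
   of which there is at least one. *)
have [Dpd Brpd] : posdef (- (B_II B + diagv K)) /\ posdef (- Br).
  have : posdef (shunt_mx B K 0).
    have i0 : K (Ordinal m_gt0) 0 < 0 by [].
    apply: (@posdef_grounded_laplacian _ _ edge B _ (rshift n (Ordinal m_gt0))) => //.
      by move=> i; case: (split_ordP i) => k ->; rewrite ?col_mxEu ?col_mxEd ?mxE// ltW.
    by rewrite col_mxEd.
  move/(shunt_posdefP K BT) => [Dpd Brpd]; split=> //; move: Brpd.
  by rewrite /diagv trmx0 (_ : diag_mx 0 = 0) ?addr0//; exact: linear0.
have Du : B_II B + diagv K \in unitmx.
  by rewrite -[B_II B + _]opprK -scaleN1r unitmxZ ?unitrN1// posdef_unitmx.
have Bru : Br \in unitmx.
  by rewrite -[Br]opprK -scaleN1r unitmxZ ?unitrN1// posdef_unitmx.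
have Mpd : posdef (- (Br + diagv b)).
  apply: M_matrix_posdef => //; have := Brpd.1; rewrite !linearN /= => /oppr_inj Brs.
  by rewrite linearD /= Brs tr_diag_mx.
have Mu : Br + diagv b \in unitmx.
  by rewrite -[Br + _]opprK -scaleN1r unitmxZ ?unitrN1// posdef_unitmx.
have ELE : (Br + diagv b) *m EL = Br *m Es' - Ish by rewrite /EL mulKVmx.
have EL_gt0 : positive EL.
  apply: (stieltjes_gt0 Mpd hyp_i.1) => i.
  by rewrite mulNmx ELE oppmxE submxE opprB subr_gt0.
have EIE : (B_II B + diagv K) *m EI = - (B_IL B *m EL) + diagv K *m Es.
  by rewrite /EI /W2 -mulmxA mulKVmx// mul_row_col mulNmx.
have EI_gt0 : positive EI.
  apply: (stieltjes_gt0 Dpd) => [i j ij|i].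
    rewrite oppmxE oppr_le0 addmxE /diagv [diag_mx _ _ _]mxE (negbTE ij) mulr0n addr0.
    by rewrite !mxE B_ge0// (inj_eq (@rshift_inj _ _)).
  rewrite mulNmx EIE oppmxE addmxE oppmxE mul_diagvE opprD opprK ltr_pwDr//.
    by rewrite oppr_gt0 pmulr_llt0.
  rewrite mulcvE; apply: sumr_ge0 => j _; rewrite mulr_ge0 ?(ltW (EL_gt0 j))//.
  by rewrite !mxE B_ge0// eq_sym eq_lrshift.
have BrEs : Br *m Es' = - (B_LI B *m invmx (B_II B + diagv K) *m diagv K *m Es).
  by rewrite /Es' /E_Lstar /W1 mulmxA mulmxN -!mulmxA mulKVmx// mulNmx !mulmxA.
(* The load rows reduce to [ELE] once [EI] is eliminated, and the inverter rows
   are [EIE]. *)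
have eqE : shunt_mx B K b *m col_mx EL EI = col_mx Ish (- (diagv K *m Es)).
  rewrite shunt_mx_block// mul_block_col; congr col_mx; last first.
    have -> : (- B_LI B)^T = - B_IL B by rewrite linearN /= trmx_ursub BT.
    by rewrite !mulNmx EIE opprD opprK addKr.
  pose X := B_LI B *m invmx (B_II B + diagv K) *m B_IL B.
  have LI_EI : B_LI B *m EI = - (X *m EL) - Br *m Es'.
    rewrite BrEs opprK -[EI in LHS](mulKmx Du) EIE !mulmxDr !mulmxN.
    by rewrite /X !mulmxA.
  have : B_LL B *m EL - X *m EL + diagv b *m EL = Br *m Es' - Ish.
    by rewrite -ELE mulmxDl /Br /B_red mulmxBl.
  rewrite !mulNmx LI_EI (mulmxDl _ (diagv b)).
  move: (B_LL B *m EL) (X *m EL) (diagv b *m EL) (Br *m Es') => u x v w.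
  move=> uE; have -> : Ish = w - (w - Ish) by rewrite opprB addrC subrK.
  rewrite -uE.
  by apply/matrixP => i j; rewrite !mxE; ring.
have e_gt0 : positive (col_mx EL EI).
  by move=> i; case: (split_ordP i) => j ->; rewrite ?col_mxEu ?col_mxEd.
have FE : F = state_field (shunt_mx B K b) (col_mx EL EI).
  by apply/funext => E; exact: closed_loop_state_field.
split=> //.
- split=> [|EL' [EL'_gt0 /reduced_power_flow_pos EL'E]].
    by split=> //; apply/reduced_power_flow_pos.
  by rewrite /EL -EL'E// mulKmx.
- by rewrite /dae_equilibrium FE /state_field subrr mulmx0 oppr0.
- by rewrite FE; apply: posdef_stable => //; exact/shunt_posdefP.
Qed.
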